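(* Let $n,m,r\ge 1$ and $k\ge 2$ be integers, let $A\in\mathbb{R}^{n\times n}$, $B\in\mathbb{R}^{n\times m}$, $C\in\mathbb{R}^{r\times n}$, $D\in\mathbb{R}^{r\times m}$, and consider the system $x_{t+1}=Ax_t+Bu_t+w_t$, $y_t=Cx_t+Du_t$, $t=0,1,\dots$, with random initial state $x_0\in\mathbb{R}^n$, random control inputs $u_t\in\mathbb{R}^m$ and random attacks $w_t\in\mathbb{R}^n$. Let $G^*=[D~~CB~~CAB~~\cdots~~CA^{k-2}B]\in\mathbb{R}^{r\times mk}$ and $\mathbf{U}_t^{(k)}=[u_t^T~u_{t-1}^T~\cdots~u_{t-k+1}^T]^T\in\mathbb{R}^{mk}$, and let $\mathcal{F}_t=\sigma(x_0,w_0,\dots,w_{t-1})$. Assume: (i) there are $\psi>0$ and $0\le\rho<1$ with $\|A^t\|_2\le\psi\rho^t$ for all $t\ge0$; (ii) there is $\eta>0$ such that $\|x_0\|_{\psi_2}\le\eta$ and, conditionally on $\mathcal{F}_t$, $\|w_t\|_{\psi_2}\le\eta$ for all $t\ge0$; (iii) for some $0\le p<\frac{1}{2(k-1)}$ there is a sequence $(\xi_t)_{t\ge0}$ of independent $\mathrm{Bernoulli}(p)$ variables, with $\xi_t$ independent of $\mathcal{F}_t$ for each $t$, such that $\{\xi_t=0\}\subseteq\{w_t=0\}$ for all $t\ge0$; (iv) the control inputs $u_t$ are independent with $u_t\sim N(0,\sigma^2I_m)$, $\sigma>0$. Let $q=1-(1-p)^{k-1}$ and $\nu=\frac{\|C\|_2}{1-2q}\left(\frac{\eta}{\sigma}+\sqrt{m}\,\|B\|_2\right)$.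 Then there exist constants $K_1,K_2>0$ (depending at most on $\psi$) such that for every $\delta\in(0,1]$ and every integer $$T\ge K_1\,\frac{k}{(1-2q)^2}\left[mk\log\Big(\frac{mk}{1-2q}\Big)+\log\Big(\frac1\delta\Big)\right],$$ with probability at least $1-\delta$, every minimizer $\hat G_T^*$ of $$\min_{G\in\mathbb{R}^{r\times mk}}\ \sum_{t=k-1}^{T+k-2}\big\|y_t-G\,\mathbf{U}_t^{(k)}\big\|_2$$ satisfies $$\|G^*-\hat G_T^*\|_F\le K_2\,\frac{\rho^{k-1}\nu}{1-\rho}.$$
   Context: $\|\cdot\|_2$ is the Euclidean norm of a vector or the spectral norm of a matrix; $\|\cdot\|_F$ is the Frobenius norm. For a scalar random variable $X$, $\|X\|_{\psi_2}=\inf\{s>0:\mathbb{E}[e^{X^2/s^2}]\le2\}$; for a random vector $X$, $\|X\|_{\psi_2}$ means $\|\,\|X\|_2\,\|_{\psi_2}$; ''$\|w_t\|_{\psi_2}\le\eta$ conditionally on $\mathcal{F}_t$'' means $\mathbb{E}[e^{\|w_t\|_2^2/\eta^2}\mid\mathcal{F}_t]\le2$ almost surely. Standing convention on the interplay of randomness: for every $t$, the future inputs $(u_s)_{s\ge t}$, the variables $(\xi_s)_{s\ge t}$ and the history $\sigma(x_0,w_0,\dots,w_{t-1},u_0,\dots,u_{t-1})$ are mutually independent. Apart from the stated assumptions, the attacks $w_t$ may be chosen arbitrarily by an adversary using historical information.</convention> *)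

(* Defs.v *)
From HB Require Import structures.
From mathcomp Require Export all_boot all_order all_algebra finmap.
From mathcomp Require Export all_classical all_reals all_analysis.
(* [all_analysis] omits this file, which makes \bar R a measurableType *)
From mathcomp Require Export measurable_realfun.
Export Order.TTheory GRing.Theory Num.Theory.
Export numFieldNormedType.Exports.

Set Implicit Arguments.
Unset Strict Implicit.
Unset Printing Implicit Defensive.

Local Open Scope classical_set_scope.
Local Open Scope ring_scope.

(* Matrices (hence column vectors) carry the sigma-algebra generated by their
   entries, which is the Borel one. *)
Section matrix_measurable.
Context {R : realType} {a b : nat}.

Let entries : set_system 'M[R]_(a, b) :=
  \bigcup_(ij in [set: 'I_a * 'I_b])
    g_sigma_algebra_preimage (fun M : 'M[R]_(a, b) => M ij.1 ij.2).

Let mx_measurable0 : <<s entries >> set0.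
Proof. exact: sigma_algebra0. Qed.

Let mx_measurableC X : <<s entries >> X -> <<s entries >> (~` X).
Proof. by move=> mX; rewrite -setTD; exact: sigma_algebraCD. Qed.

Let mx_measurableU (F : (set 'M[R]_(a, b))^nat) :
  (forall i, <<s entries >> (F i)) -> <<s entries >> (\bigcup_i F i).
Proof. exact: sigma_algebra_bigcup. Qed.

HB.instance Definition _ :=
  @isMeasurable.Build default_measure_display 'M[R]_(a, b)
    <<s entries >> mx_measurable0 mx_measurableC mx_measurableU.

End matrix_measurable.

Section norms.
Context {R : realType}.

Definition l2norm n (v : 'cV[R]_n) : R := Num.sqrt (\sum_i v i 0 ^+ 2).

Definition spectral_norm a b (M : 'M[R]_(a, b)) : R :=
  sup [set l2norm (M *m v) | v in [set v : 'cV[R]_b | l2norm v <= 1]].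

Definition frobenius_norm a b (M : 'M[R]_(a, b)) : R :=
  Num.sqrt (\sum_i \sum_j M i j ^+ 2).

End norms.

Section probability_notions.
Context d (T : measurableType d) (R : realType) (P : probability T R).

(* Mutual independence of a family of sub-sigma-algebras: product rule over
   every finite subfamily. *)
Definition mutually_independent (I : choiceType) (G : I -> set_system T) :=
  forall (J : {fset I}) (E : I -> set T),
    (forall i, i \in J -> G i (E i)) ->
    P (\bigcap_(i in [set` J]) E i) = (\prod_(i <- J) P (E i))%E.

(* [g] is a version of the conditional expectation of the nonnegative [f] given
   the sub-sigma-algebra [G]. *)
Definition is_cond_expectation (G : set_system T) (f : T -> R)
    (g : T -> \bar R) :=
  [/\ forall Y : set (\bar R), measurable Y -> G (g @^-1` Y),
      forall o, (0 <= g o)%E &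
      forall E, G E ->
        (\int[P]_(o in E) g o = \int[P]_(o in E) (f o)%:E)%E].

(* +oo when no scale [s] is admissible. *)
Definition psi2_norm (X : T -> R) : \bar R :=
  ereal_inf [set s%:E | s in [set s : R | 0 < s /\
    ('E_P[fun o => expR (X o ^+ 2 / s ^+ 2)] <= 2%:E)%E]].

Definition cond_psi2_le (G : set_system T) (X : T -> R) (eta : R) :=
  exists g : T -> \bar R,
    is_cond_expectation G (fun o => expR (X o ^+ 2 / eta ^+ 2)) g /\
    {ae P, forall o, (g o <= 2%:E)%E}.

(* N(0, sigma^2 I_m); [normal_prob] takes the standard deviation. *)
Definition isotropic_gaussian (m : nat) (sigma : R) (X : T -> 'cV[R]_m) :=
  mutually_independent
    (fun i : 'I_m => g_sigma_algebra_preimage (fun o => X o i 0)) /\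
  forall (i : 'I_m) (Y : set R), measurable Y ->
    P ((fun o => X o i 0) @^-1` Y) = normal_prob 0 sigma Y.

Definition is_bernoulli (p : R) (X : T -> bool) :=
  forall Y : set bool, P (X @^-1` Y) = bernoulli_prob p Y.

End probability_notions.

Section generated_sigma_algebras.
Context d (T : measurableType d) (R : realType) (n m : nat).

Definition sigma_future d' (T' : measurableType d') (z : nat -> T -> T')
    (t : nat) : set_system T :=
  <<s \bigcup_(s >= t) g_sigma_algebra_preimage (z s) >>.

Definition sigma_attacks (x0 : T -> 'cV[R]_n) (w : nat -> T -> 'cV[R]_n)
    (t : nat) : set_system T :=
  <<s g_sigma_algebra_preimage x0 `|`
      \bigcup_(s < t) g_sigma_algebra_preimage (w s) >>.

Definition sigma_history (x0 : T -> 'cV[R]_n) (w : nat -> T -> 'cV[R]_n)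
    (u : nat -> T -> 'cV[R]_m) (t : nat) : set_system T :=
  <<s g_sigma_algebra_preimage x0 `|`
      \bigcup_(s < t) g_sigma_algebra_preimage (w s) `|`
      \bigcup_(s < t) g_sigma_algebra_preimage (u s) >>.

End generated_sigma_algebras.

(* The dimension m k is written [\sum_(j < k) m], the form in which MathComp's
   block matrices carry their k blocks of size m. *)
Section estimator.
Context {R : realType} {n m r : nat}.

Definition markov_params (k : nat) (A : 'M[R]_n) (B : 'M[R]_(n, m))
    (C : 'M[R]_(r, n)) (D : 'M[R]_(r, m)) : 'M[R]_(r, \sum_(j < k) m) :=
  \mxrow_(j < k) (if j == 0%N :> nat then D else C *m A ^+ j.-1 *m B).

(* Only used for t >= k - 1, where [t - j] does not truncate. *)
Definition stacked_input (k : nat) (u : nat -> 'cV[R]_m) (t : nat)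
    : 'cV[R]_(\sum_(j < k) m) :=
  \mxcol_(j < k) u (t - j)%N.

Definition l2_loss (k N : nat) (u : nat -> 'cV[R]_m) (y : nat -> 'cV[R]_r)
    (G : 'M[R]_(r, \sum_(j < k) m)) : R :=
  \sum_(k.-1 <= t < N + k.-1) l2norm (y t - G *m stacked_input k u t).

Definition is_minimizer (V : Type) (f : V -> R) (v : V) :=
  forall v' : V, f v <= f v'.

End estimator.

(* Main.v *)
From HB Require Import structures.
Require Import Defs.
From mathcomp Require Import ring lra zify.

(* Let Delta = G* - G for a minimizer G, let U_t be the stacked inputs, and call
   t attacked if one of w_{t-1}, ..., w_{t-k+1} may be nonzero, which happens
   with probability at most q < 1/2. Off the attacked times the loss of G
   exceeds that of G* by at least |Delta U_t| - 2 |C A^(k-1) x_{t-k+1}|, at the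
   attacked ones by at least - |Delta U_t|, so that
     sum_t s_t |Delta U_t| <= 2 sum_t |C A^(k-1) x_{t-k+1}|,
   where s_t = -1 at the attacked times and 1 elsewhere. It remains to bound the
   left-hand side from below, uniformly in Delta, by a multiple of
   N (1 - 2q) sigma |Delta|_F.

   For a fixed row vector v, the signs are independent of the inputs, so that
   s_t |v U_t| has mean (1 - 2q) E|v U_t|, and the times t in a residue class
   modulo k involve disjoint windows of independent variables: a Chernoff bound
   gives the lower bound for v, and a union bound over a cubic grid of mesh of
   order (1 - 2q)/(mk), together with a bound on the energy of the inputs, gives
   it for all v at once. To pass from row vectors to matrices without paying for
   the number r of rows, take v = g^T Delta with g a standard Gaussian vector of
   R^r and integrate over g: E|<g, z>| is a constant multiple of |z|, for
   attacked and unattacked times alike. *)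

Set Implicit Arguments.
Unset Strict Implicit.
Unset Printing Implicit Defensive.

Local Open Scope classical_set_scope.
Local Open Scope ring_scope.

(** * Integration of functions adapted to a sub-sigma-algebra *)

(** The adversary sees past inputs, so the event that [w_t] is nonzero may depend on the inputs of
    the very windows in which [w_t] occurs. Attacked times are therefore defined through the
    variables [xi], which are independent of all inputs. The truncation errors are never made to
    concentrate: along each path their sum is at most a multiple of [1 / (1 - rho)] times the sum of
    the driving terms. Those are controlled by two exponential moments, one of the Gaussian inputs
    and one of the attacks, obtained by successive conditioning. On the resulting event everything
    is deterministic and holds for all minimizers at once. The sample size reflects the union bound.
    A residue class has at least [N / (2 k)] windows, whence the factor [k]; one class and one grid
    point fail with probability at most [exp (- N kap^2 / (2^16 k))], where [kap = 1 - 2 q]; and the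
    logarithm of the number of grid points is of order [mk log (mk / kap)]. *)

Section adapted.
Context d (T : measurableType d).
Implicit Type G : set_system T.

Definition sub_sigma_algebra_of G :=
  sigma_algebra [set: T] G /\ G `<=` measurable.

(** Stated for plain set systems, the form in which the hypotheses supply their sigma-algebras;
    [adapted_g_sigma] gives access to the usual closure properties, since a sigma-algebra equals the
    one it generates. *)
Definition adapted d' (T' : measurableType d') G (f : T -> T') :=
  forall Y, measurable Y -> G (f @^-1` Y).

Lemma adapted_measurable d' (T' : measurableType d') G (f : T -> T') :
  sub_sigma_algebra_of G -> adapted G f -> measurable_fun [set: T] f.
Proof. by move=> [_ sG] fG _ Y mY; rewrite setTI; exact/sG/fG. Qed.

Lemma adapted_g_sigma d' (T' : measurableType d') G (f : T -> T') :
  sub_sigma_algebra_of G ->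
  adapted G f <-> measurable_fun [set: g_sigma_algebraType G] f.
Proof.
move=> [saG _]; split => [fG _ Y mY|mf Y mY].
  by rewrite setTI; apply: sub_sigma_algebra; exact: fG.
have := mf measurableT Y mY.
by rewrite setTI /measurable/= sigma_algebra_id.
Qed.

End adapted.

Section integral_of_adapted.
Context d (T : measurableType d) (R : realType).
Variables (mu1 mu2 : {measure set T -> \bar R}) (f1 f2 : T -> \bar R).
Hypotheses (mf1 : measurable_fun [set: T] f1) (mf2 : measurable_fun [set: T] f2).
Hypotheses (f10 : forall x, (0 <= f1 x)%E) (f20 : forall x, (0 <= f2 x)%E).
Variable G : set_system T.
Hypothesis saG : sub_sigma_algebra_of G.
Hypothesis eqG : forall E, G E ->
  (\int[mu1]_(x in E) f1 x = \int[mu2]_(x in E) f2 x)%E.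
Local Open Scope ereal_scope.
Import HBNNSimple.

Let measurable_GE (A : set T) :
  measurable (A : set (g_sigma_algebraType G)) -> G A.
Proof. by rewrite /measurable/= sigma_algebra_id//; case: saG. Qed.

Let nnsfun_eq (mu : {measure set T -> \bar R}) (f : T -> \bar R)
    (h : {nnsfun (g_sigma_algebraType G) >-> R}) :
  measurable_fun [set: T] f -> (forall x, 0 <= f x) ->
  \int[mu]_x ((h x)%:E * f x) =
  \sum_(r \in range h) r%:E * \int[mu]_(x in h @^-1` [set r]) f x.
Proof.
move=> mf f0.
have mh r : measurable (h @^-1` [set r] : set T).
  apply: saG.2; apply: measurable_GE.
  exact: (measurable_funPTI h).
under eq_integral => x _.
  rewrite fimfunE -fsumEFin// ge0_mule_fsuml; last first.
    by move=> r; exact: (nnfun_muleindic_ge0 h).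
  over.
rewrite ge0_integral_fsum//=.
- apply: eq_fsbigr => r; rewrite inE => -[x _ <-].
  under eq_integral do rewrite EFinM -muleA.
  rewrite ge0_integralZl//.
  + rewrite [in RHS]integral_mkcond; congr (_ * _); apply: eq_integral => y _;
    by rewrite patchE indicE; case: ifPn => _; rewrite ?mul1e ?mul0e.
  + apply: emeasurable_funM => //; apply/measurable_EFinP.
    exact: measurable_indic.
  + by move=> y _; rewrite mule_ge0.
  + by rewrite lee_fin.
- move=> r; apply: emeasurable_funM => //; apply/measurable_EFinP.
  by apply: measurable_funM => //; exact: measurable_indic.
- move=> r x _; rewrite mule_ge0//; exact: (nnfun_muleindic_ge0 h).
Qed.

(** Simple functions over [G] have their level sets in [G], so [eqG] settles them, and monotone
    convergence does the rest. It serves for densities, for products of independent functions, and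
    for pulling an adapted factor out of a conditional expectation. *)
Lemma ge0_integral_adapted (M : T -> \bar R) : adapted G M ->
  (forall x, 0 <= M x) -> \int[mu1]_x (M x * f1 x) = \int[mu2]_x (M x * f2 x).
Proof.
move=> /(adapted_g_sigma _ saG) mM M0.
pose h := nnsfun_approx measurableT mM.
have mh n : measurable_fun [set: T] (EFin \o h n).
  apply: (adapted_measurable saG); apply/(adapted_g_sigma _ saG).
  exact/measurable_EFinP.
have lim_h (mu : {measure set T -> \bar R}) (f : T -> \bar R) :
    measurable_fun [set: T] f -> (forall x, 0 <= f x) ->
    \int[mu]_x (M x * f x) = limn (fun n => \int[mu]_x ((h n x)%:E * f x)).
  move=> mf f0; rewrite -monotone_convergence//.
  - apply: eq_integral => x _; apply/esym/cvg_lim => //.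
    have hM : (h n x)%:E @[n --> \oo] --> M x by exact: cvg_nnsfun_approx.
    have [fxfin|] := boolP (f x \is a fin_num); first exact: cvgeZr.
    rewrite ge0_fin_numE// -leNgt leye_eq => /eqP fxy.
    (* Multiplication by [+oo] is not continuous at 0; but if [M x = 0], every approximant lies
       below [M x] and vanishes. *)
    have [Mx0|Mx0] := eqVneq (M x) 0.
      rewrite Mx0 mul0e (_ : (fun n => _) = cst 0); first exact: cvg_cst.
      apply/funext => n /=; suff -> : h n x = 0%R by rewrite mul0e.
      have : (h n x)%:E <= M x.
        rewrite /h nnsfun_approxE.
        by apply: (@le_approx _ (g_sigma_algebraType G)) => //= y _.
      by rewrite Mx0 lee_fin => hnx; apply/eqP; rewrite eq_le hnx fun_ge0.
    apply: cvgeM; [|exact: hM|exact: cvg_cst].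
    by apply: mule_def_neq0_infty; rewrite // fxy.
  - by move=> n; apply: emeasurable_funM => //; exact: mh.
  - by move=> n x _; rewrite mule_ge0 ?lee_fin.
  - move=> x _ a b ab; apply: lee_wpmul2r => //.
    rewrite lee_fin; move: x.
    exact/lefP/(@nd_nnsfun_approx _ (g_sigma_algebraType G)).
rewrite !lim_h//; congr (limn _); apply/funext => n.
rewrite !nnsfun_eq//; apply: eq_fsbigr => r _; congr (_ * _); apply: eqG.
apply: measurable_GE.
exact: (measurable_funPTI (h n)).
Qed.

End integral_of_adapted.

(** * Gaussian integrals *)

Section gaussian_integrals.
Context {R : realType}.
Notation mu := (@lebesgue_measure R).
Notation N01 := (@normal_prob R 0 1).
Local Open Scope ereal_scope.

Lemma sub_sigma_algebra_measurable d (T : measurableType d) :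
  sub_sigma_algebra_of (@measurable d T).
Proof. by split=> //; exact: sigma_algebra_measurable. Qed.

Lemma integral_normal_prob (s : R) (f : R -> \bar R) :
  measurable_fun [set: R] f -> (forall x, 0 <= f x) ->
  \int[normal_prob 0 s]_x f x = \int[mu]_x (f x * (normal_pdf 0 s x)%:E).
Proof.
move=> mf f0.
transitivity (\int[normal_prob 0%R s]_x (f x * 1)).
  by apply: eq_integral => x _; rewrite mule1.
apply: (ge0_integral_adapted _ _ _ _
  (@sub_sigma_algebra_measurable _ (measurableTypeR R))) => //.
- by apply/measurable_EFinP; exact: measurable_normal_pdf.
- by move=> x; rewrite lee_fin normal_pdf_ge0.
- by move=> E mE; rewrite integral_cst// mul1e.
- by move=> Y mY; rewrite -[_ @^-1` _]setTI; exact: mf.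
Qed.

(** The image of Lebesgue measure under the affine map, scaled by [c], has the right mass on
    half-open intervals, which determines it. *)
Lemma ge0_integral_affine (c e : R) (f : R -> \bar R) : (0 < c)%R ->
  measurable_fun [set: R] f -> (forall x, 0 <= f x) ->
  \int[mu]_x f x = c%:E * \int[mu]_x f (c * x + e)%R.
Proof.
move=> c0 mf f0.
pose phi : measurableTypeR R -> measurableTypeR R := fun x => (c * x + e)%R.
have mphi : measurable_fun [set: R] phi.
  by apply: measurable_funD => //; exact: measurable_funM.
pose c' : {nonneg R} := NngNum (ltW c0).
pose nu := measure_function_pushforward__canonical__measure_function_Measure
  mu mphi.
transitivity (\int[mscale c' nu]_x f x).
  apply: eq_measure_integral => A mA _.
  apply: lebesgue_measure_unique => //= _ [[a b] _ <-].
  rewrite /mscale/= /pushforward.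
  have -> : phi @^-1` `]a, b] = `]((a - e) / c)%R, ((b - e) / c)%R]%classic.
    apply/seteqP; split => x /=; rewrite !in_itv/= ltr_pdivrMr// ler_pdivlMr//;
    by rewrite /phi ltrBlDr lerBrDr [(x * c)%R]mulrC.
  rewrite !lebesgue_measure_itv/= !lte_fin ltr_pM2r ?invr_gt0// ltrD2r.
  case: ifP => _; rewrite ?mule0// -!EFinB -EFinM -mulrBl mulrCA divff ?gt_eqF//.
  by rewrite mulr1; congr EFin; ring.
rewrite ge0_integral_mscale//=; congr (_ * _).
by rewrite ge0_integral_pushforward.
Qed.

Lemma normal_pdf_neq0E (m s x : R) : (s != 0)%R ->
  (normal_pdf m s x = normal_peak s * normal_fun m s x)%R.
Proof. by move=> s0; rewrite normal_pdfE. Qed.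

(** The ratio of two centered Gaussian densities, in the form that lets a factor [expR (a * x ^+ 2)]
    be absorbed into a change of variance. *)
Lemma normal_pdf01E (s : R) : (s != 0)%R -> forall x, normal_pdf 0 1 x =
  (normal_pdf 0 s x * (normal_peak 1 / normal_peak s)
    * expR (x ^+ 2 * ((s ^+ 2)^-1 - 1) / 2))%R.
Proof.
move=> s0 x; rewrite !normal_pdf_neq0E ?oner_eq0//.
have ps : normal_peak s != 0%R by rewrite gt_eqF// normal_peak_gt0.
transitivity (normal_peak 1 *
    (normal_fun 0 s x * expR (x ^+ 2 * ((s ^+ 2)^-1 - 1) / 2)))%R; last first.
  move: ps; move: (normal_peak s) (normal_peak 1) (normal_fun _ _ _) (expR _).
  by move=> a b e f a0; field.
congr (_ * _)%R; rewrite /normal_fun -expRD; congr expR.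
by rewrite !mulr2n; field; rewrite s0 -mulr2n mulrn_eq0 expf_eq0 (negbTE s0).
Qed.

Lemma normal_peakV (s : R) : (0 < s)%R -> (normal_peak 1 / normal_peak s = s)%R.
Proof.
move=> s0; rewrite /normal_peak invrK -!mulrnAr.
rewrite (@sqrtrM _ (1 ^+ 2)) ?sqr_ge0// (@sqrtrM _ (s ^+ 2)) ?sqr_ge0//.
rewrite !sqrtr_sqr normr1 mul1r (gtr0_norm s0) mulrCA mulVf ?mulr1//.
by rewrite gt_eqF// sqrtr_gt0 pmulrn_lgt0// pi_gt0.
Qed.

Lemma integral_expR_sqr (a : R) : (a < 2^-1)%R ->
  \int[N01]_x (expR (a * x ^+ 2))%:E = ((Num.sqrt (1 - 2 * a))^-1)%:E.
Proof.
move=> a2; have a0 : (0 < 1 - 2 * a)%R by lra.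
pose s := (Num.sqrt (1 - 2 * a))^-1%R.
have s0 : (0 < s)%R by rewrite invr_gt0 sqrtr_gt0.
have mexp : measurable_fun [set: R] (fun x : R => (expR (a * x ^+ 2))%:E).
  apply/measurable_EFinP; apply: measurableT_comp => //.
  by apply: measurable_funM => //; exact: measurable_funX.
rewrite integral_normal_prob//.
transitivity (\int[mu]_x (s%:E * (normal_pdf 0 s x)%:E)).
  apply: eq_integral => x _; rewrite -!EFinM; congr EFin.
  rewrite (@normal_pdf01E s) ?gt_eqF// normal_peakV//.
  rewrite mulrC -!mulrA -expRD [X in expR X](_ : _ = 0)%R.
    by rewrite expR0 mulr1 mulrC.
  by rewrite /s exprVn invrK sqr_sqrtr ?ltW//; field.
rewrite ge0_integralZl//.
- by rewrite integral_normal_pdf mule1.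
- by apply/measurable_EFinP; exact: measurable_normal_pdf.
- by move=> x _; rewrite lee_fin normal_pdf_ge0.
- by rewrite lee_fin ltW.
Qed.

Lemma integral_normalN (f : R -> \bar R) :
  measurable_fun [set: R] f -> (forall x, 0 <= f x) ->
  \int[N01]_x f (- x)%R = \int[N01]_x f x.
Proof.
move=> mf f0.
have mNf : measurable_fun [set: R] (fun x : R => f (- x)%R).
  exact: measurableT_comp.
have mg : measurable_fun [set: R] (fun x : R => f x * (normal_pdf 0 1 x)%:E).
  apply: emeasurable_funM => //; apply/measurable_EFinP.
  exact: measurable_normal_pdf.
have mN : measurable_fun [set: measurableTypeR R]
  (-%R : measurableTypeR R -> measurableTypeR R) by exact: oppr_measurable.
pose nu := measure_function_pushforward__canonical__measure_function_Measure
  mu mN.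
rewrite !integral_normal_prob//.
transitivity (\int[nu]_x (f x * (normal_pdf 0 1 x)%:E)).
  rewrite (ge0_integral_pushforward mN mu measurableT mg).
    apply: eq_integral => x _ /=; congr (_ * (_)%:E).
    by rewrite !normal_pdfE ?oner_eq0// /normal_fun !subr0 sqrrN.
  by move=> x _; rewrite mule_ge0// lee_fin normal_pdf_ge0.
by apply: eq_measure_integral => A mA _; exact: lebesgue_measureN.
Qed.

(** For independent standard [x], [y] and [w = a x + b y], the joint density of [(w, y)] is that of
    [w] times the conditional density [N(b w, a^2)] of [y]; [a^-1] is the Jacobian of
    [x = (w - b y) / a]. *)
Let normal_pdf_rotation (a b w y : R) : (0 < a)%R -> (a ^+ 2 + b ^+ 2 = 1)%R ->
  (a^-1 * (normal_pdf 0 1 y * normal_pdf 0 1 ((w - b * y) / a)) =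
  normal_pdf 0 1 w * normal_pdf (b * w) a y)%R.
Proof.
move=> a0 ab; have a0' : a != 0%R by rewrite gt_eqF.
have := normal_peakV a0 => pa.
have p1 : normal_peak 1 != 0%R :> R by rewrite gt_eqF// normal_peak_gt0.
have {}pa : normal_peak a = (a^-1 * normal_peak 1)%R.
  have : normal_peak a != 0%R by rewrite gt_eqF// normal_peak_gt0.
  move: pa a0' p1; move: (normal_peak a) (normal_peak 1) => e f <- + f0 e0.
  by move=> _; field; rewrite e0.
rewrite !normal_pdf_neq0E ?oner_eq0// pa /normal_fun.
set p := normal_peak 1.
have re (t x1 x2 : R) : (t * (p * x1 * (p * x2)) = t * p * p * (x1 * x2))%R by ring.
have re' (t x1 x2 : R) : (p * x1 * (t * p * x2) = t * p * p * (x1 * x2))%R by ring.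
rewrite re re' -!expRD; congr (_ * expR _)%R.
rewrite !subr0 !expr1n exprMn exprVn.
have -> : ((w - b * y) ^+ 2 = w ^+ 2 * a ^+ 2 + (y - b * w) ^+ 2 - y ^+ 2 * a ^+ 2
    + (w ^+ 2 - y ^+ 2) * (1 - (a ^+ 2 + b ^+ 2)))%R by ring.
rewrite ab subrr mulr0 addr0 mulr2n.
by field.
Qed.

(** Substitute [w = a x + b y] for [x], exchange the integrals, and use that the conditional density
    of [y] integrates to 1. *)
Let integral_normal_rotation1 (a b : R) (h : R -> \bar R) :
  measurable_fun [set: R] h -> (forall x, 0 <= h x) ->
  (0 < a)%R -> (a ^+ 2 + b ^+ 2 = 1)%R ->
  \int[N01]_x \int[N01]_y h (a * x + b * y)%R = \int[N01]_x h x.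
Proof.
move=> mh h0 a0 ab.
have mpdf (m s : R) : measurable_fun [set: R] (fun x => (normal_pdf m s x)%:E).
  by apply/measurable_EFinP; exact: measurable_normal_pdf.
have pdf0 m s x : 0 <= (normal_pdf m s x)%:E :> \bar R.
  by rewrite lee_fin normal_pdf_ge0.
have mlin (x0 : R) : measurable_fun [set: R] (fun x => a * x + x0)%R.
  by apply: measurable_funD => //; exact: measurable_funM.
pose g (z : measurableTypeR R * measurableTypeR R) :=
  h z.1 * ((normal_pdf 0 1 z.2)%:E *
    (a^-1 * normal_pdf 0 1 ((z.1 - b * z.2) / a))%:E).
have mg : measurable_fun [set: _] g.
  apply: emeasurable_funM; first exact: measurableT_comp.
  apply: emeasurable_funM; first exact: (measurableT_comp (mpdf 0%R 1%R)).
  apply/measurable_EFinP; apply: measurable_funM => //.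
  apply: (measurableT_comp (measurable_normal_pdf 0%R 1%R)).
  apply: measurable_funM => //; apply: measurable_funB => //.
  exact: measurable_funM.
have g0 z : 0 <= g z.
  rewrite /g mule_ge0// mule_ge0// lee_fin mulr_ge0// ?invr_ge0 ?(ltW a0)//.
  exact: normal_pdf_ge0.
have mhN : measurable_fun [set: R * R]
    (fun z : measurableTypeR R * measurableTypeR R => h (a * z.1 + b * z.2)%R).
  apply: measurableT_comp => //; apply: measurable_funD; exact: measurable_funM.
rewrite (fubini_tonelli (m1 := N01) (m2 := N01) (fun z => h (a * z.1 + b * z.2)%R))//=.
transitivity (\int[mu]_y \int[mu]_x g (x, y)).
  rewrite integral_normal_prob; last 2 first.
    exact: (measurable_fun_fubini_tonelli_G (m1 := N01)
      (fun z => h (a * z.1 + b * z.2)%R)).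
    by move=> y; exact: integral_ge0.
  apply: eq_integral => y _.
  have mgy : measurable_fun [set: R] (fun x => g (x, y)).
    exact: (measurableT_comp mg (measurable_pair2 y)).
  rewrite [RHS](ge0_integral_affine (b * y)%R a0 mgy) => [|x]; last exact: g0.
  have mha : measurable_fun [set: R] (fun x => h (a * x + b * y)%R).
    exact: measurableT_comp.
  have mgl : measurable_fun [set: R] (fun x => g ((a * x + b * y)%R, y)).
    exact: (measurableT_comp mgy).
  have a0' : 0 <= a%:E :> \bar R by rewrite lee_fin ltW.
  rewrite -(ge0_integralZl mu measurableT mgl (fun x _ => g0 _) a0').
  rewrite integral_normal_prob//.
  have mhp : measurable_fun [set: R]
      (fun x => h (a * x + b * y)%R * (normal_pdf 0 1 x)%:E).
    exact: emeasurable_funM.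
  rewrite -(ge0_integralZr mu measurableT mhp
    (fun x _ => mule_ge0 (h0 _) (pdf0 _ _ _)))//.
  apply: eq_integral => x _; rewrite /g/= addrK [(a * x)%R]mulrC.
  rewrite mulfK ?gt_eqF// muleCA -muleA; congr (_ * _).
  by rewrite -!EFinM; congr EFin; field; rewrite gt_eqF.
rewrite -(fubini_tonelli (m1 := mu) (m2 := mu) g)//=.
rewrite integral_normal_prob//; apply: eq_integral => w _.
rewrite /g/=.
transitivity (\int[mu]_y ((h w * (normal_pdf 0 1 w)%:E) *
    (normal_pdf (b * w) a y)%:E)).
  apply: eq_integral => y _; rewrite -muleA; congr (_ * _).
  by rewrite -!EFinM -normal_pdf_rotation// mulrCA.
rewrite (ge0_integralZl mu measurableT (mpdf _ _) (fun _ _ => pdf0 _ _ _)).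
  by rewrite integral_normal_pdf mule1.
exact: mule_ge0.
Qed.

Lemma integral_normal_rotation (a b : R) (h : R -> \bar R) :
  measurable_fun [set: R] h -> (forall x, 0 <= h x) ->
  (0 <= a)%R -> (0 <= b)%R ->
  \int[N01]_x \int[N01]_y h (a * x + b * y)%R =
  \int[N01]_x h (Num.sqrt (a ^+ 2 + b ^+ 2) * x)%R.
Proof.
move=> mh h0; rewrite le_eqVlt => /predU1P[<-|a0] b0.
  rewrite expr0n/= add0r sqrtr_sqr ger0_norm//.
  under eq_integral do under eq_integral do rewrite mul0r add0r.
  rewrite (integral_cst (N01 : {measure set _ -> \bar R}))//.
  by rewrite [X in _ * X](probability_setT N01) mule1.
set c := Num.sqrt _.
have c0 : (0 < c)%R by rewrite sqrtr_gt0 ltr_wpDr ?exprn_gt0 ?sqr_ge0.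
have mhc : measurable_fun [set: R] (fun x => h (c * x)%R).
  by apply: measurableT_comp => //; exact: measurable_funM.
have abc : ((a / c) ^+ 2 + (b / c) ^+ 2 = 1)%R.
  rewrite !exprMn -mulrDl exprVn sqr_sqrtr ?addr_ge0 ?sqr_ge0// divff//.
  by rewrite gt_eqF// -sqrtr_gt0.
rewrite -(integral_normal_rotation1 mhc (fun=> h0 _) (divr_gt0 a0 c0) abc).
apply: eq_integral => x _; apply: eq_integral => y _; congr (h _).
by field; rewrite gt_eqF.
Qed.

End gaussian_integrals.

(** * Elementary bounds on the exponential *)

Section exponential_inequalities.
Context {R : realType}.
Implicit Type x t : R.

Lemma expRM1B_le1 t : expR t * (1 - t) <= 1.
Proof.
rewrite -[leRHS](expR0) -(subrr t) expRD ler_pM2l ?expR_gt0//.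
exact: expR_ge1Dx.
Qed.

Lemma expR_le_taylor2 t : expR t <= 1 + t + t ^+ 2 * expR `|t|.
Proof.
have [t0|t0] := leP 0 t.
  have := expRM1B_le1 t; have := expR_ge1Dx t; rewrite ger0_norm//.
  move: (expR t) => e e1 e2; nra.
have := expRM1B_le1 (- t); rewrite ltr0_norm// opprK => h.
have h1 : 1 <= expR (- t) by rewrite -expR0 ler_expR; lra.
have h2 : expR t * (1 - t) <= 1.
  exact: expRM1B_le1.
have h3 : 0 < expR t by exact: expR_gt0.
have t2 : t ^+ 2 <= t ^+ 2 * expR (- t) by rewrite ler_peMr// sqr_ge0.
nra.
Qed.

Lemma expR2_le10 : expR 2 <= 10 :> R.
Proof.
have h : expR 4^-1 <= 4 / 3 :> R by have := expRM1B_le1 (4^-1); lra.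
have -> : 2 = 8%:R * 4^-1 :> R by field.
rewrite expRM_natl; apply: (@le_trans _ _ ((4 / 3) ^+ 8)); last by lra.
by rewrite lerXn2r// nnegrE ?expR_ge0//; lra.
Qed.

(** From [x^2 / 8 <= expR (x^2 / 8)] and [|x| <= 2 + x^2 / 8], with [expR 2 <= 10]. The exponent
    [x^2 / 4] stays below [x^2 / 2], so the right-hand side has a finite Gaussian mean. *)
Lemma sqr_expR_norm_le x : x ^+ 2 * expR `|x| <= 80 * expR (x ^+ 2 / 4).
Proof.
have h1 : x ^+ 2 <= 8 * expR (x ^+ 2 / 8) by have := expR_ge1Dx (x ^+ 2 / 8); lra.
have h2 : expR `|x| <= 10 * expR (x ^+ 2 / 8).
  apply: le_trans (_ : expR 2 * expR (x ^+ 2 / 8) <= _).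
    rewrite -expRD ler_expR -[x ^+ 2]real_normK ?num_real//.
    have := sqr_ge0 (`|x| - 4); nra.
  by rewrite ler_pM2r ?expR_gt0// expR2_le10.
have -> : 80 * expR (x ^+ 2 / 4) = 8 * expR (x ^+ 2 / 8) * (10 * expR (x ^+ 2 / 8)).
  have -> : x ^+ 2 / 4 = x ^+ 2 / 8 + x ^+ 2 / 8 by field.
  by rewrite expRD; ring.
by rewrite ler_pM ?sqr_ge0 ?expR_ge0.
Qed.

End exponential_inequalities.

(** * Mean and Laplace transform of the absolute value of a Gaussian *)

Section gaussian_moments.
Context {R : realType}.
Notation N01 := (@normal_prob R 0 1).
Local Open Scope ereal_scope.

Let mexp (a : R) : measurable_fun [set: R] (fun x : R => expR (a * x ^+ 2)).
Proof.
by apply: measurableT_comp => //; apply: measurable_funM.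
Qed.

(** The exact value is [sqrt (2 / pi)]; the proof works with its finiteness and the lower bound
    [1/4]. *)
Definition gauss_mean_abs : R := fine (\int[N01]_x (`|x|%R)%:E).

Lemma gauss_mean_absE : \int[N01]_x (`|x|%R)%:E = gauss_mean_abs%:E.
Proof.
rewrite fineK// ge0_fin_numE; last by apply: integral_ge0.
apply: (@le_lt_trans _ _ (\int[N01]_x (expR (4^-1 * x ^+ 2))%:E)).
  apply: ge0_le_integral => //; first exact/measurable_EFinP.
    by apply/measurable_EFinP; exact: mexp.
  move=> x _; rewrite lee_fin.
  apply: le_trans (expR_ge1Dx _); rewrite -[(x ^+ 2)%R]real_normK ?num_real//.
  have := sqr_ge0 (`|x| / 2 - 1)%R; nra.
by rewrite integral_expR_sqr ?ltry//; lra.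
Qed.

(** Integrate [1 <= |x| + expR (- x^2 / 2)]; the last term has mean [1 / sqrt 2 <= 3/4]. *)
Lemma gauss_mean_abs_ge : (4^-1 <= gauss_mean_abs)%R.
Proof.
have e1 : 1 <= \int[N01]_x (`|x|%R)%:E + \int[N01]_x (expR (- 2^-1 * x ^+ 2))%:E.
  have m1 : measurable_fun [set: R] (fun x : R => (`|x|%R)%:E).
    exact/measurable_EFinP.
  have m2 : measurable_fun [set: R] (fun x : R => (expR (- 2^-1 * x ^+ 2))%:E).
    by apply/measurable_EFinP; exact: mexp.
  rewrite -ge0_integralD//.
  rewrite -[leLHS](probability_setT N01) -[leLHS]mul1e -integral_cst//.
  apply: ge0_le_integral => //=; first exact: emeasurable_funD.
  move=> x _; rewrite -EFinD lee_fin.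
  have := expR_ge1Dx (- 2^-1 * x ^+ 2)%R.
  have := expR_ge0 (- 2^-1 * x ^+ 2)%R.
  rewrite -[(x ^+ 2)%R]real_normK ?num_real//.
  have := normr_ge0 x; have [] := leP 1%R `|x|%R; nra.
have e2 : \int[N01]_x (expR (- 2^-1 * x ^+ 2))%:E <= (3 / 4)%:E.
  rewrite integral_expR_sqr; last by lra.
  rewrite lee_fin; set q := Num.sqrt _.
  have q0 : (0 < q)%R by rewrite sqrtr_gt0; lra.
  have : (q ^+ 2 = 2 :> R)%R by rewrite sqr_sqrtr; lra.
  by rewrite -[(q^-1)%R]div1r ler_pdivrMr//; nra.
move: e1; rewrite gauss_mean_absE => e1.
have := le_trans e1 (leeD2l _ e2).
by rewrite -EFinD lee_fin; lra.
Qed.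

(** A second-order expansion under the integral; [128] exceeds [80 * sqrt 2], where [sqrt 2] is the
    mean of [expR (x^2 / 4)]. Negative [l] are allowed because attacked windows enter with the
    opposite sign. *)
Lemma integral_expR_abs_le (l : R) : (`|l| <= 1)%R ->
  \int[N01]_x (expR (- l * `|x|))%:E <=
  (1 - l * gauss_mean_abs + 128 * l ^+ 2)%:E.
Proof.
move=> l1.
have int1 : N01.-integrable [set: R] (fun x => (`|x|%R)%:E).
  apply/integrableP; split; first exact/measurable_EFinP.
  under eq_integral do rewrite /= normr_id.
  by rewrite gauss_mean_absE ltry.
have int2 : N01.-integrable [set: R] (fun x => (expR (4^-1 * x ^+ 2))%:E).
  apply/integrableP; split; first by apply/measurable_EFinP; exact: mexp.
  under eq_integral do rewrite /= ger0_norm ?expR_ge0//.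
  by rewrite integral_expR_sqr ?ltry//; lra.
have int0 : N01.-integrable [set: R] (cst (1%R)%:E).
  by apply: finite_measure_integrable_cst.
pose F x : R := (1 - l * `|x| + 80 * l ^+ 2 * expR (4^-1 * x ^+ 2))%R.
have ptw x : (expR (- l * `|x|) <= F x)%R.
  apply: le_trans (expR_le_taylor2 _) _.
  rewrite /F mulNr lerD2l normrN normrM normr_id sqrrN exprMn.
  rewrite real_normK ?num_real//.
  have -> : (80 * l ^+ 2 * expR (4^-1 * x ^+ 2) =
      l ^+ 2 * (80 * expR (x ^+ 2 / 4)))%R.
    by rewrite [(x ^+ 2 / 4)%R]mulrC; ring.
  have l0 : (0 <= l ^+ 2)%R by exact: sqr_ge0.
  have h1 : (x ^+ 2 * expR (`|l| * `|x|) <= 80 * expR (x ^+ 2 / 4))%R.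
    apply: le_trans (sqr_expR_norm_le _).
    by rewrite ler_wpM2l ?sqr_ge0// ler_expR ler_piMl.
  by rewrite -mulrA ler_wpM2l.
apply: (@le_trans _ _ (\int[N01]_x (F x)%:E)).
  apply: ge0_le_integral => //.
  - apply/measurable_EFinP; apply: measurableT_comp => //.
    by apply: measurable_funM => //.
  - apply/measurable_EFinP; apply: measurable_funD.
      by apply: measurable_funB => //; exact: measurable_funM.
    by apply: measurable_funM => //; exact: mexp.
  - by move=> x _; rewrite lee_fin.
under eq_integral do rewrite /F EFinD EFinB EFinM (EFinM (80 * _)%R).
rewrite integralD//; last 2 first.
- by apply: integrableB => //; exact: integrableZl.
- exact: integrableZl.
rewrite integralB//; last exact: integrableZl.
rewrite !integralZl// gauss_mean_absE integral_cst//.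
rewrite [X in _ * X](probability_setT N01) mule1.
rewrite integral_expR_sqr; last by lra.
rewrite -!EFinM -EFinB -EFinD lee_fin lerD2l.
rewrite [leRHS]mulrC [(80 * _)%R]mulrC -mulrA ler_wpM2l ?sqr_ge0//.
set q := Num.sqrt _.
have q0 : (0 < q)%R by rewrite sqrtr_gt0; lra.
have : (q ^+ 2 = 2^-1 :> R)%R by rewrite sqr_sqrtr; lra.
rewrite ler_pdivrMr//; nra.
Qed.

End gaussian_moments.

(** * Independence *)

Section sigma_algebras.
Context d (T : measurableType d).

Lemma sub_sigma_algebra_g (G : set_system T) :
  G `<=` measurable -> sub_sigma_algebra_of <<s G >>.
Proof.
move=> sG; split; first exact: smallest_sigma_algebra.
by apply: smallest_sub => //; exact: sigma_algebra_measurable.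
Qed.

Lemma sub_sigma_algebra_preimage d' (T' : measurableType d') (f : T -> T') :
  measurable_fun [set: T] f -> sub_sigma_algebra_of (g_sigma_algebra_preimage f).
Proof.
move=> mf; split.
  by apply: sigma_algebra_preimage; exact: sigma_algebra_measurable.
by move=> _ [Y mY <-]; exact: mf.
Qed.

Lemma adapted_preimage d' (T' : measurableType d') (f : T -> T') :
  adapted (g_sigma_algebra_preimage f) f.
Proof. by move=> Y mY; exists Y => //; rewrite setTI. Qed.

Lemma adapted_sub d' (T' : measurableType d') (G H : set_system T) (f : T -> T') :
  G `<=` H -> adapted G f -> adapted H f.
Proof. by move=> GH fG Y mY; exact/GH/fG. Qed.

Lemma adapted_comp d1 d2 (T1 : measurableType d1) (T2 : measurableType d2)
    (G : set_system T) (f : T -> T1) (g : T1 -> T2) :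
  measurable_fun [set: T1] g -> adapted G f -> adapted G (g \o f).
Proof.
move=> mg fG Y mY; apply: (fG (g @^-1` Y)).
by rewrite -[X in measurable X]setTI; exact: mg.
Qed.

Lemma sub_sigma_setI (G : set_system T) A B :
  sub_sigma_algebra_of G -> G A -> G B -> G (A `&` B).
Proof.
case=> saG _; rewrite -(sigma_algebra_id saG).
exact: (@measurableI _ (g_sigma_algebraType G)).
Qed.

Lemma sub_sigma_setT (G : set_system T) : sub_sigma_algebra_of G -> G [set: T].
Proof.
case=> saG _; rewrite -(sigma_algebra_id saG).
exact: (@measurableT _ (g_sigma_algebraType G)).
Qed.

End sigma_algebras.

Section independence.
Context d (T : measurableType d) (R : realType) (P : probability T R).
Implicit Types A B : set_system T.
Local Open Scope ereal_scope.

Definition indep_sigma A B :=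
  forall E F, A E -> B F -> P (E `&` F) = P E * P F.

(** [ge0_integral_adapted] is used first with weight [g], trading the indicator of [E] for the
    constant [P E], then with weight [f], trading [g] for its mean. *)
Lemma expectation_indep A B (f g : T -> \bar R) :
  sub_sigma_algebra_of A -> sub_sigma_algebra_of B -> indep_sigma A B ->
  adapted A f -> adapted B g -> (forall x, 0 <= f x) -> (forall x, 0 <= g x) ->
  \int[P]_x (f x * g x) = \int[P]_x f x * \int[P]_x g x.
Proof.
move=> saA saB AB fA gB f0 g0.
have mf := adapted_measurable saA fA; have mg := adapted_measurable saB gB.
have step E : A E -> \int[P]_(x in E) g x = P E * \int[P]_x g x.
  move=> AE; have mE := saA.2 _ AE.
  have m1E : measurable_fun [set: T] (fun x => (\1_E x)%:E : \bar R).
    by apply/measurable_EFinP; exact: measurable_indic.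
  transitivity (\int[P]_x (g x * (\1_E x)%:E)).
    rewrite integral_mkcond; apply: eq_integral => x _.
    by rewrite patchE indicE; case: ifPn; rewrite ?mule1 ?mule0.
  rewrite (ge0_integral_adapted (mu2 := P) (f2 := cst (P E)) m1E _ _ _ saB _ gB g0)//.
    by rewrite ge0_integralZr// muleC.
  move=> F BF; have mF := saB.2 _ BF.
  rewrite integral_indic// integral_cst//; exact: AB.
transitivity (\int[P]_x (f x * (cst (\int[P]_y g y)) x)).
  apply: (ge0_integral_adapted mg _ _ _ saA _ fA f0) => //=.
    by move=> x; exact: integral_ge0.
  move=> E AE; rewrite step// integral_cst//; last exact: saA.2.
  by rewrite muleC.
by rewrite ge0_integralZr//; exact: integral_ge0.
Qed.

Lemma indep_sigmaC A B : indep_sigma A B -> indep_sigma B A.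
Proof. by move=> AB E F BE AF; rewrite setIC AB// muleC. Qed.

Lemma indep_sigma_sub A B A' B' : A `<=` A' -> B `<=` B' ->
  indep_sigma A' B' -> indep_sigma A B.
Proof. by move=> AA BB AB E F AE BF; apply: AB; [exact: AA|exact: BB]. Qed.

(** For fixed [F], the restriction of [P] to [F] and the multiple [P F] of [P] are finite measures
    that agree on the pi-system [A], hence on the sigma-algebra it generates. *)
Let indep_sigma_gl A B : A `<=` measurable -> B `<=` measurable ->
  setI_closed A -> A [set: T] -> indep_sigma A B -> indep_sigma <<s A >> B.
Proof.
move=> mA mB AI AT AB E F AE BF; have mF := mB _ BF.
have [c PFE] : exists c : {nonneg R}, P F = c%:num%:E.
  exists (NngNum (fine_ge0 (measure_ge0 P F))).
  by rewrite fineK// fin_num_measure.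
have : mrestr P mF E = mscale c P E.
  apply: (g_sigma_algebra_measure_unique A mA (fun=> setT)) => //.
  - by rewrite bigcup_const//; exists 0%N.
  - move=> X AX; rewrite -[LHS]/(P (X `&` F)) -[RHS]/(c%:num%:E * P X).
    by rewrite -PFE muleC; exact: AB.
  - by move=> _; rewrite -[ltLHS]/(P (setT `&` F)) setTI PFE ltry.
by rewrite /mrestr /mscale => ->; rewrite -PFE muleC.
Qed.

Lemma indep_sigma_g A B : A `<=` measurable -> B `<=` measurable ->
  setI_closed A -> setI_closed B -> A [set: T] -> B [set: T] ->
  indep_sigma A B -> indep_sigma <<s A >> <<s B >>.
Proof.
move=> mA mB AI BI AT BT AB.
apply: indep_sigma_gl => //; first by have [] := sub_sigma_algebra_g mB.
by apply: indep_sigmaC; apply: indep_sigma_gl => //; exact: indep_sigmaC.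
Qed.

Context (I : choiceType) (F : I -> set_system T).
Hypothesis saF : forall i, sub_sigma_algebra_of (F i).
Hypothesis indepF : mutually_independent P F.

Definition sigma_on (J : set I) : set_system T := <<s \bigcup_(i in J) F i >>.

Let mcyl J : \bigcup_(i in J) F i `<=` measurable.
Proof. by move=> E [i _] /(saF i).2. Qed.

Lemma sub_sigma_algebra_on J : sub_sigma_algebra_of (sigma_on J).
Proof. exact: sub_sigma_algebra_g. Qed.

Lemma sigma_on_sub J J' : J `<=` J' -> sigma_on J `<=` sigma_on J'.
Proof. by move=> JJ; apply: sub_sigma_algebra2; exact: bigcup_subset. Qed.

Lemma sigma_on_mem J i : J i -> F i `<=` sigma_on J.
Proof. by move=> Ji E Fi; apply: sub_sigma_algebra; exists i. Qed.

(* Finite intersections, written as intersections over all indices of sets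
   that are trivial off [J] and off a finite set. *)
Let cyl (J : set I) : set_system T :=
  [set \bigcap_i E i | E in [set E : I -> set T |
    [/\ forall i, F i (E i), forall i, ~ J i -> E i = setT &
        exists K : {fset I}, forall i, i \notin K -> E i = setT]]].

Let cyl_bigcap (E : I -> set T) (K : {fset I}) :
  (forall i, i \notin K -> E i = setT) ->
  \bigcap_i E i = \bigcap_(i in [set` K]) E i.
Proof.
move=> ET; apply/seteqP; split=> x Ex i _; first exact: Ex.
by have [iK|iK] := boolP (i \in K); [exact: Ex|rewrite ET].
Qed.

Let P_cyl (E : I -> set T) (K : {fset I}) : (forall i, F i (E i)) ->
  (forall i, i \notin K -> E i = setT) ->
  P (\bigcap_i E i) = \prod_(i <- K) P (E i).
Proof. by move=> FE ET; rewrite (cyl_bigcap ET) indepF. Qed.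


Let cyl_setI J : setI_closed (cyl J).
Proof.
move=> _ _ [E [FE JE [K KE]] <-] [E' [FE' JE' [K' KE']] <-].
exists (fun i => E i `&` E' i); last by rewrite bigcapI.
split=> [i|i Ji|]; first exact: sub_sigma_setI.
  by rewrite JE// JE'// setTI.
exists (K `|` K')%fset => i; rewrite in_fsetU negb_or => /andP[iK iK'].
by rewrite KE// KE'// setTI.
Qed.

Let cyl_setT J : cyl J setT.
Proof.
exists (fun=> setT); last by rewrite bigcapT.
by split=> // [i|]; [exact: sub_sigma_setT|exists fset0].
Qed.

Let cyl_measurable J : cyl J `<=` measurable.
Proof.
move=> _ [E [FE _ [K KE]] <-]; rewrite (cyl_bigcap KE) bigcap_fset.
by apply: big_ind => // [|i _]; [exact: measurableI|exact: (saF i).2].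
Qed.

Let sub_sigma_cyl J : sigma_on J `<=` <<s cyl J >>.
Proof.
apply: sub_sigma_algebra2 => A [i Ji FA].
exists (fun j => if j == i then A else setT).
  split=> [j|j|]; [|by case: eqP => // ->|].
    by case: eqP => [->//|_]; exact: sub_sigma_setT.
  by exists [fset i]%fset => j; rewrite inE => /negbTE ->.
apply/seteqP; split=> [x /(_ i Logic.I)|x Ax j _]; first by rewrite eqxx.
by case: eqP.
Qed.

(** Cylinders form pi-systems generating both sides. As [J] and [J'] are disjoint, at each index one
    of the two factors is the whole space, so the product rule splits index by index. *)
Lemma indep_sigma_on J J' : J `&` J' = set0 ->
  indep_sigma (sigma_on J) (sigma_on J').
Proof.
move=> JJ0.
apply: (indep_sigma_sub (@sub_sigma_cyl J) (@sub_sigma_cyl J')).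
apply: indep_sigma_g => // _ _ [E [FE JE [K KE]] <-] [E' [FE' JE' [K' KE']] <-].
have EE' i : E i = setT \/ E' i = setT.
  have [Ji|nJi] := pselect (J i); last by left; exact: JE.
  by right; apply: JE' => J'i; rewrite -[False]/(set0 i) -JJ0.
pose L := (K `|` K')%fset.
have LE i : i \notin L -> E i = setT.
  by rewrite in_fsetU negb_or => /andP[iK _]; exact: KE.
have LE' i : i \notin L -> E' i = setT.
  by rewrite in_fsetU negb_or => /andP[_ iK]; exact: KE'.
rewrite -bigcapI (P_cyl FE LE) (P_cyl FE' LE') (@P_cyl _ L).
- rewrite -big_split/=; apply: eq_bigr => i _.
  by have [->|->] := EE' i; rewrite (setTI, setIT) probability_setT (mul1e, mule1).
- by move=> i; exact: sub_sigma_setI.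
- by move=> i iL; rewrite LE// LE'// setTI.
Qed.

End independence.

(** * Centered Gaussian variables *)

Section centered_gaussian.
Context d (T : measurableType d) (R : realType) (P : probability T R).
Notation N01 := (@normal_prob R 0 1).
Local Open Scope ereal_scope.

Lemma integral_normal_prob_scale (s : R) (f : R -> \bar R) : (0 < s)%R ->
  measurable_fun [set: R] f -> (forall x, 0 <= f x) ->
  \int[normal_prob 0 s]_x f x = \int[N01]_x f (s * x)%R.
Proof.
move=> s0 mf f0.
have mpdf (e : R) : measurable_fun [set: R] (fun x => (normal_pdf 0 e x)%:E).
  by apply/measurable_EFinP; exact: measurable_normal_pdf.
have pdf0 e x : 0 <= (normal_pdf 0 e x)%:E :> \bar R.
  by rewrite lee_fin normal_pdf_ge0.
have mfs : measurable_fun [set: R] (fun x => f (s * x)%R).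
  by apply: measurableT_comp => //; exact: measurable_funM.
have mg : measurable_fun [set: R] (fun x => f x * (normal_pdf 0 s x)%:E).
  exact: emeasurable_funM.
have g0 x : 0 <= f x * (normal_pdf 0 s x)%:E by exact: mule_ge0.
rewrite (integral_normal_prob s mf f0) (integral_normal_prob 1 mfs (fun=> f0 _)).
rewrite (ge0_integral_affine 0 s0 mg g0).
have mlin : measurable_fun [set: R] (fun x => s * x + 0)%R.
  by apply: measurable_funD => //; exact: measurable_funM.
have mgs : measurable_fun [set: R]
    (fun x => f (s * x + 0)%R * (normal_pdf 0 s (s * x + 0))%:E).
  exact: (measurableT_comp mg mlin).
have s0' : 0 <= s%:E :> \bar R by rewrite lee_fin ltW.
rewrite -(ge0_integralZl lebesgue_measure measurableT mgs (fun x _ => g0 _) s0').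
apply: eq_integral => x _; rewrite addr0 muleCA; congr (_ * _).
rewrite -EFinM; congr EFin.
have s1 : s != 0%R by rewrite gt_eqF.
rewrite [in RHS](normal_pdf01E s1) normal_peakV//.
rewrite !normal_pdf_neq0E//.
have -> : normal_fun 0 s (s * x) =
    (normal_fun 0 s x * expR (x ^+ 2 * ((s ^+ 2)^-1 - 1) / 2))%R.
  rewrite /normal_fun -expRD; congr expR.
  by rewrite !subr0 !mulr2n; field; rewrite s1 -mulr2n mulrn_eq0 expf_eq0 (negbTE s1).
by rewrite mulrCA -!mulrA; congr (_ * _)%R; rewrite mulrCA.
Qed.

(** The law of [a] times a standard Gaussian. Unlike a density, this form admits [a = 0] and
    negative [a], which arise from vanishing or negative coefficients. *)
Definition is_gauss (X : T -> R) (a : R) := forall f : R -> \bar R,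
  measurable_fun [set: R] f -> (forall x, 0 <= f x) ->
  \int[P]_o f (X o) = \int[N01]_x f (a * x)%R.

Lemma is_gauss_law (X : T -> R) (s : R) : (0 < s)%R ->
  measurable_fun [set: T] X ->
  (forall Y, measurable Y -> P (X @^-1` Y) = normal_prob 0 s Y) -> is_gauss X s.
Proof.
move=> s0 mX XE f mf f0; rewrite -integral_normal_prob_scale//.
have mX' : measurable_fun [set: T] (X : T -> measurableTypeR R) by exact: mX.
pose nu := measure_function_pushforward__canonical__measure_function_Measure
  P mX'.
transitivity (\int[nu]_x f x).
  by rewrite (ge0_integral_pushforward mX' P measurableT mf).
by apply: eq_measure_integral => A mA _; exact: XE.
Qed.

Lemma is_gauss0 : is_gauss (fun=> 0%R) 0.
Proof.
move=> f mf f0; under [RHS]eq_integral do rewrite mul0r.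
rewrite (integral_cst P measurableT) (integral_cst N01 measurableT).
by rewrite [X in _ * X](probability_setT P) mule1
  [X in _ * X](probability_setT N01) mule1.
Qed.

Lemma is_gaussZ (X : T -> R) (a c : R) :
  is_gauss X a -> is_gauss (fun o => c * X o)%R (c * a).
Proof.
move=> gX f mf f0.
rewrite (gX (fun x => f (c * x)%R))//.
  by under eq_integral do rewrite mulrA.
by apply: measurableT_comp => //; exact: measurable_funM.
Qed.

Lemma is_gauss_norm (X : T -> R) (a : R) : is_gauss X a -> is_gauss X `|a|.
Proof.
move=> gX f mf f0; rewrite gX//; have [a0|a0] := leP 0%R a.
  by rewrite ger0_norm.
rewrite -(@integral_normalN _ (fun x => f (`|a| * x)%R))//.
  by apply: eq_integral => x _; rewrite ltr0_norm// mulrNN.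
by apply: measurableT_comp => //; exact: measurable_funM.
Qed.

(** By independence the joint law of [(X, Y)] is the product of the marginals, and
    [integral_normal_rotation] evaluates the double integral; symmetry first makes both scales
    nonnegative. *)
Lemma is_gaussD (A B : set_system T) (X Y : T -> R) (a b : R) :
  sub_sigma_algebra_of A -> sub_sigma_algebra_of B -> indep_sigma P A B ->
  adapted A X -> adapted B Y -> is_gauss X a -> is_gauss Y b ->
  is_gauss (fun o => X o + Y o)%R (Num.sqrt (a ^+ 2 + b ^+ 2)).
Proof.
move=> saA saB AB XA YB /is_gauss_norm gX /is_gauss_norm gY f mf f0.
have mX := adapted_measurable saA XA; have mY := adapted_measurable saB YB.
have mXY : measurable_fun [set: T] (fun o => (X o, Y o)).
  exact: measurable_fun_pair.
pose X' : {mfun T >-> R} := HB.pack X (isMeasurableFun.Build _ _ _ _ X mX).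
pose Y' : {mfun T >-> R} := HB.pack Y (isMeasurableFun.Build _ _ _ _ Y mY).
pose nu := measure_function_pushforward__canonical__measure_function_Measure
  P mXY.
pose g (z : R * R) := f (z.1 + z.2)%R.
have mg : measurable_fun [set: R * R] g.
  by apply: measurableT_comp => //; exact: measurable_funD.
have g0 z : 0 <= g z by exact: f0.
transitivity (\int[nu]_z g z).
  by rewrite (ge0_integral_pushforward mXY P measurableT mg).
transitivity (\int[distribution P X' \x distribution P Y']_z g z).
  apply: eq_measure_integral => C mC _; apply/esym.
  apply: product_measure_unique => // A1 A2 mA1 mA2.
  exact: (AB _ _ (XA _ mA1) (YB _ mA2)).
rewrite fubini_tonelli1//=.
have mgx x : measurable_fun [set: R] (fun y => f (x + y)%R).
  by apply: measurableT_comp => //; exact: measurable_funD.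
transitivity (\int[distribution P X']_x \int[N01]_y f (x + `|b| * y)%R).
  apply: eq_integral => x _.
  rewrite -(gY (fun y => f (x + y)%R))//.
  exact: (ge0_integral_pushforward mY P measurableT (mgx x) (fun=> fun=> f0 _)).
have mF : measurable_fun [set: R] (fun x => \int[N01]_y f (x + `|b| * y)%R).
  apply: (measurable_fun_fubini_tonelli_F (m2 := N01)
    (fun z : R * measurableTypeR R => f (z.1 + `|b| * z.2)%R)) => //.
  apply: measurableT_comp => //; apply: measurable_funD => //.
  exact: measurable_funM.
have F0 x : 0 <= \int[N01]_y f (x + `|b| * y)%R by exact: integral_ge0.
rewrite [LHS](ge0_integral_pushforward mX P measurableT mF (fun=> fun=> F0 _)).
rewrite [LHS](gX (fun x => \int[N01]_y f (x + `|b| * y)%R))//.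
rewrite integral_normal_rotation//.
by rewrite !real_normK ?num_real.
Qed.

Context (I : choiceType) (F : I -> set_system T).
Hypothesis saF : forall i, sub_sigma_algebra_of (F i).
Hypothesis indepF : mutually_independent P F.

Lemma adapted_sum (G : set_system T) (K : eqType) (s : seq K) (v : K -> R)
    (X : K -> T -> R) : sub_sigma_algebra_of G ->
  (forall e, e \in s -> adapted G (X e)) ->
  adapted G (fun o => \sum_(e <- s) v e * X e o)%R.
Proof.
move=> saG XG; apply/(adapted_g_sigma _ saG); elim: s XG => [|e s ih] XG.
  under eq_fun do rewrite big_nil; exact: measurable_cst.
under eq_fun do rewrite big_cons.
apply: measurable_funD; last by apply: ih => i si; apply: XG; rewrite inE si orbT.
apply: measurable_funM => //; apply/(adapted_g_sigma _ saG).
by apply: XG; rewrite inE eqxx.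
Qed.

(** Since the indices [al e] are distinct, the head term is independent of the sum over the tail,
    which is adapted to the other indices; variances then add by [is_gaussD]. *)
Lemma is_gauss_sum (K : eqType) (s : seq K) (al : K -> I) (v : K -> R)
    (X : K -> T -> R) (sg : R) : (0 <= sg)%R -> uniq (map al s) ->
  (forall e, adapted (F (al e)) (X e)) -> (forall e, is_gauss (X e) sg) ->
  is_gauss (fun o => \sum_(e <- s) v e * X e o)%R
    (sg * Num.sqrt (\sum_(e <- s) v e ^+ 2)).
Proof.
move=> sg0 + XF gX; elim: s => [_|e s ih /= /andP[es us]].
  rewrite big_nil sqrtr0 mulr0; under eq_fun do rewrite big_nil.
  exact: is_gauss0.
pose J := [set i | i \in map al s].
have FJ : indep_sigma P (F (al e)) (sigma_on F J).
  apply: (indep_sigma_sub (A' := sigma_on F [set al e]) (B' := sigma_on F J)).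
  - exact: sigma_on_mem.
  - by [].
  - apply: indep_sigma_on => //; rewrite -subset0 => _ /= [-> h].
    by rewrite /J/= h in es.
have mvX : adapted (F (al e)) (fun o => v e * X e o)%R.
  apply/(adapted_g_sigma _ (saF _)); apply: measurable_funM => //.
  by apply/(adapted_g_sigma _ (saF _)).
have sJ : adapted (sigma_on F J) (fun o => \sum_(e <- s) v e * X e o)%R.
  apply: adapted_sum; first exact: sub_sigma_algebra_on.
  move=> i si; apply: (adapted_sub _ (XF i)); apply: sigma_on_mem.
  by rewrite /J/=; exact: map_f.
have := is_gaussD (saF _) (sub_sigma_algebra_on saF J) FJ mvX sJ
  (is_gaussZ (v e) (gX e)) (ih us).
under [X in is_gauss X _ -> _]eq_fun do rewrite -[(_ + _)%R](big_cons _ _ e s xpredT).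
rewrite big_cons; congr (is_gauss _ _).
rewrite !exprMn sqr_sqrtr; last by apply: sumr_ge0 => i _; exact: sqr_ge0.
rewrite mulrC -mulrDr sqrtrM ?sqr_ge0// sqrtr_sqr ger0_norm//.
Qed.

End centered_gaussian.

(** * Exponential moments *)

Section exponential_moments.
Context d (T : measurableType d) (R : realType) (P : probability T R).
Notation N01 := (@normal_prob R 0 1).
Local Open Scope ereal_scope.

Lemma chernoff_bound (X : T -> R) (B L : R) : measurable_fun [set: T] X ->
  \int[P]_o (expR (X o))%:E <= B%:E ->
  P [set o | (L <= X o)%R] <= (B * expR (- L))%:E.
Proof.
move=> mX XB; set A := [set o | _].
have mA : measurable A.
  rewrite (_ : A = X @^-1` `[L, +oo[); last first.
    by apply/seteqP; split=> o /=; rewrite in_itv/= andbT.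
  by rewrite -[X in measurable X]setTI; exact: mX.
have mexp : measurable_fun [set: T] (fun o => (expR (X o))%:E).
  by apply/measurable_EFinP; exact: measurableT_comp.
have e0 : 0 <= (expR (- L))%:E :> \bar R by rewrite lee_fin expR_ge0.
apply: (@le_trans _ _ (\int[P]_o ((expR (X o))%:E * (expR (- L))%:E))).
  have <- : \int[P]_o (\1_A o)%:E = P A by rewrite integral_indic// setIT.
  apply: ge0_le_integral => //.
  - by apply/measurable_EFinP; exact: measurable_indic.
  - exact: emeasurable_funM.
  move=> o _; rewrite -EFinM lee_fin indicE -expRD.
  have [|_] := boolP (o \in A); last exact: expR_ge0.
  by rewrite inE/= => Lo; rewrite -expR0 ler_expR subr_ge0.
rewrite ge0_integralZr//.
by rewrite EFinM lee_wpmul2r.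
Qed.

(** Splitting on [b] replaces [l] by [- l] with probability [q], so the first-order terms combine to
    [- l * (1 - 2 * q)] times the Gaussian mean, which is at least [1/4]; then [1 + t <= expR t]. *)
Lemma integral_signed_abs (A B : set_system T) (b : T -> bool) (Z : T -> R)
    (q l : R) :
  sub_sigma_algebra_of A -> sub_sigma_algebra_of B -> indep_sigma P A B ->
  adapted A b -> adapted B Z -> is_gauss P Z 1 ->
  P (b @^-1` [set true]) = q%:E -> (2 * q <= 1)%R -> (0 <= l <= 1)%R ->
  \int[P]_o (expR (- l * ((-1) ^+ b o * `|Z o|)))%:E <=
  (expR (- l * ((1 - 2 * q) / 4) + 128 * l ^+ 2))%:E.
Proof.
move=> saA saB AB bA ZB gZ Pb q2 /andP[l0 l1].
have q0 : (0 <= q)%R by rewrite -lee_fin -Pb measure_ge0.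
have mZ := adapted_measurable saB ZB; have mb := adapted_measurable saA bA.
have mE (e : R) : measurable_fun [set: R] (fun x : R => expR (- e * `|x|)).
  by apply: measurableT_comp => //; exact: measurable_funM.
have phi (e : R) : (`|e| <= 1)%R -> \int[P]_o (expR (- e * `|Z o|))%:E <=
    (1 - e * gauss_mean_abs + 128 * e ^+ 2)%:E.
  move=> e1; rewrite (gZ (fun x => (expR (- e * `|x|))%:E)).
  - under eq_integral do rewrite mul1r; exact: integral_expR_abs_le.
  - by apply/measurable_EFinP.
  - by move=> x; rewrite lee_fin expR_ge0.
pose c (v : bool) o : R := (b o == v)%:R.
have cA v : adapted A (EFin \o c v).
  have -> : EFin \o c v = (fun w : bool => ((w == v)%:R)%:E) \o b by [].
  by apply: adapted_comp bA => //; exact: measurable_fun_bool.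
have Pc v : \int[P]_o (c v o)%:E = P (b @^-1` [set v]).
  have mbv : measurable (b @^-1` [set v]).
    by rewrite -[X in measurable X]setTI; exact: mb.
  transitivity (\int[P]_o (\1_(b @^-1` [set v]) o)%:E).
    apply: eq_integral => o _; rewrite /c indicE; congr ((nat_of_bool _)%:R%:E).
    by apply/idP/idP => [/eqP bo|/set_mem/= ->]; [exact: mem_set|exact: eqxx].
  by rewrite integral_indic// setIT.
have Pb' : P (b @^-1` [set false]) = (1 - q)%:E.
  rewrite (_ : _ @^-1` _ = ~` (b @^-1` [set true])).
    rewrite probability_setC ?Pb ?EFinB//.
    by rewrite -[X in measurable X]setTI; exact: mb.
  by apply/seteqP; split=> o /=; case: (b o).
have Eadapt (e : R) : adapted B (fun o => (expR (- e * `|Z o|))%:E).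
  have mEe : measurable_fun [set: R] (fun x : R => (expR (- e * `|x|))%:E).
    exact/measurable_EFinP.
  exact: (adapted_comp mEe ZB).
have E0 (e : R) o : 0 <= (expR (- e * `|Z o|))%:E by rewrite lee_fin expR_ge0.
have c0 v o : 0 <= (c v o)%:E by rewrite lee_fin ler0n.
have split_b v (e : R) : \int[P]_o ((c v o)%:E * (expR (- e * `|Z o|))%:E) =
    P (b @^-1` [set v]) * \int[P]_o (expR (- e * `|Z o|))%:E.
  by rewrite -Pc; exact: (expectation_indep saA saB AB (cA v) (Eadapt e) (c0 v) (E0 e)).
have mcE v (e : R) : measurable_fun [set: T]
    (fun o => (c v o)%:E * (expR (- e * `|Z o|))%:E).
  apply: emeasurable_funM; first exact: (adapted_measurable saA (cA v)).
  exact: (adapted_measurable saB (Eadapt e)).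
have -> : \int[P]_o (expR (- l * ((-1) ^+ b o * `|Z o|)))%:E =
    \int[P]_o ((c true o)%:E * (expR (- - l * `|Z o|))%:E +
    (c false o)%:E * (expR (- l * `|Z o|))%:E).
  apply: eq_integral => o _; rewrite -!EFinM -EFinD; congr EFin; rewrite /c.
  case: (b o); rewrite !eqE/= ?expr1 ?expr0 ?mul1r ?mul0r ?addr0 ?add0r//.
  by rewrite mulN1r mulrN -mulNr.
rewrite ge0_integralD//; last 2 first.
- by move=> o _; exact: mule_ge0.
- by move=> o _; exact: mule_ge0.
rewrite !split_b Pb Pb'.
have l1' : (`|l| <= 1)%R by rewrite ger0_norm.
have lN1 : (`|- l| <= 1)%R by rewrite normrN.
have q0' : 0 <= q%:E :> \bar R by rewrite lee_fin.
have q1 : 0 <= (1 - q)%:E :> \bar R by rewrite lee_fin; lra.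
apply: le_trans (leeD (lee_wpmul2l q0' (phi _ lN1)) (lee_wpmul2l q1 (phi _ l1'))) _.
rewrite -!EFinM -EFinD lee_fin; apply: le_trans (expR_ge1Dx _).
have := @gauss_mean_abs_ge R; move: gauss_mean_abs => g.
have q3 : (0 <= 1 - 2 * q)%R by rewrite subr_ge0.
rewrite -subr_ge0 => g4'; rewrite sqrrN.
have := mulr_ge0 (mulr_ge0 l0 q3) g4'; lra.
Qed.

Context (I : choiceType) (F : I -> set_system T).
Hypothesis saF : forall i, sub_sigma_algebra_of (F i).
Hypothesis indepF : mutually_independent P F.

(** The product of the earlier factors depends on the union of their blocks, which is disjoint from
    the last block, so the expectation factors. The predicate [Q] serves to keep only the windows
    that start before the end of the sample. *)
Lemma integral_prod_blocks (J : nat -> set I) (Q : pred nat) (f : nat -> T -> R)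
    (b : R) (n : nat) :
  (forall i j, (i < j < n)%N -> J i `&` J j = set0) ->
  (forall j, adapted (sigma_on F (J j)) (f j)) ->
  (forall j o, (0 <= f j o)%R) ->
  (forall j, Q j -> \int[P]_o (f j o)%:E <= b%:E) ->
  \int[P]_o (\prod_(j < n | Q j) f j o)%:E <= (b ^+ (\sum_(j < n | Q j) 1)%N)%:E.
Proof.
move=> JJ fJ f0 fb.
pose past n := \bigcup_(j < n) J j.
have past_adapted k : adapted (sigma_on F (past k))
    (fun o => \prod_(j < k | Q j) f j o)%R.
  apply/(adapted_g_sigma _ (sub_sigma_algebra_on saF _)).
  under eq_fun do rewrite big_mkcond/=.
  apply: measurable_prod => j _; have [_|//] := boolP (Q j).
  apply/(adapted_g_sigma _ (sub_sigma_algebra_on saF _)).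
  apply: (adapted_sub _ (fJ j)); apply: sigma_on_sub => a Ja.
  by exists (j : nat) => //=; exact: ltn_ord.
have mEF : measurable_fun [set: R] (EFin : R -> \bar R) by exact/measurable_EFinP.
elim: n JJ => [|n ih] JJ.
  rewrite big_ord0 expr0;
  rewrite (eq_integral (cst 1)) => [|o _]; last by rewrite big_ord0.
  by rewrite integral_cst// [X in _ * X](probability_setT P) mule1.
rewrite [in leRHS]big_mkcond/= big_ord_recr/= -big_mkcond/=.
under eq_integral => o _ do rewrite big_mkcond/= big_ord_recr/= -big_mkcond/=.
have {}ih : \int[P]_o (\prod_(j < n | Q j) f j o)%:E <=
    (b ^+ (\sum_(j < n | Q j) 1)%N)%:E.
  by apply: ih => i j /andP[ij jn]; apply: JJ; rewrite ij ltnW.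
case: ifPn => Qn; last first.
  by under eq_integral do rewrite mulr1; rewrite addn0.
under eq_integral do rewrite EFinM.
rewrite (@expectation_indep _ _ _ _ (sigma_on F (past n)) (sigma_on F (J n))
  (fun o => (\prod_(j < n | Q j) f j o)%:E) (fun o => (f n o)%:E)).
- rewrite exprD expr1 EFinM; apply: lee_pmul => //.
  + by apply: integral_ge0 => o _; rewrite lee_fin prodr_ge0.
  + by apply: integral_ge0 => o _; rewrite lee_fin.
  + exact: fb.
- exact: sub_sigma_algebra_on.
- exact: sub_sigma_algebra_on.
- apply: indep_sigma_on => //; rewrite -subset0 => a [[j /= jn Ja] Jna].
  have := JJ j n; rewrite jn ltnSn => /(_ isT).
  by rewrite -subset0 => /(_ a (conj Ja Jna)).
- exact: (adapted_comp mEF (past_adapted n)).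
- exact: (adapted_comp mEF (fJ n)).
- by move=> o; rewrite lee_fin prodr_ge0.
- by move=> o; rewrite lee_fin.
Qed.

End exponential_moments.

(** * The independent family of inputs and attack indicators *)

Section regrouping.
Context d (T : measurableType d) (R : realType) (P : probability T R).
Local Open Scope ereal_scope.

Definition product_rule (I : choiceType) (F : I -> set_system T) (Q : pred I) :=
  forall (J : {fset I}) (E : I -> set T),
    (forall i, i \in J -> Q i /\ F i (E i)) ->
    P (\bigcap_(i in [set` J]) E i) = \prod_(i <- J) P (E i).

Lemma product_rule_reindex (I K : choiceType) (h : K -> I) (h' : I -> K)
    (F : I -> set_system T) (Q : pred I) :
  cancel h h' -> (forall i, Q i -> h (h' i) = i) ->
  mutually_independent P (F \o h) -> product_rule F Q.
Proof.
move=> hK hQ indF J E JE.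
pose J' := (h' @` J)%fset.
have JJ' : J = (h @` J')%fset.
  apply/fsetP => i; apply/idP/imfsetP => /= [iJ|[_ /imfsetP[/= j jJ ->] ->]].
    exists (h' i); first exact: in_imfset.
    by rewrite hQ//; exact: (JE _ iJ).1.
  by rewrite hQ//; exact: (JE _ jJ).1.
rewrite {2}JJ' big_imfset/=; last by move=> a b _ _; exact: (can_inj hK).
rewrite -(indF J' (E \o h)) => [|k kJ'].
  congr (P _); apply/seteqP; split=> o /= Eo i.
    by move=> iJ'; apply: (Eo (h i)); rewrite /= JJ'; exact: in_imfset.
  by rewrite /= JJ' => /imfsetP[/= j jJ' ->]; exact: Eo.
by apply: (JE (h k) _).2; rewrite JJ'; exact: in_imfset.
Qed.

(** Group the intersection by the value of [g]: each part lies in [G c], so [indG] separates the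
    groups and [inner] factors each of them. It is applied twice: to the three families of the
    standing convention, then to the entries of each input. *)
Lemma mutually_independent_nested (I K : choiceType) (g : I -> K)
    (F : I -> set_system T) (G : K -> set_system T) :
  (forall c, sigma_algebra [set: T] (G c)) ->
  (forall i, F i `<=` G (g i)) -> mutually_independent P G ->
  (forall c, product_rule F [pred i | g i == c]) -> mutually_independent P F.
Proof.
move=> saG FG indG inner J E JE.
pose Jc c := [fset i in J | g i == c]%fset.
pose A c := \bigcap_(i in [set` Jc c]) E i.
have GA c : G c (A c).
  rewrite /A bigcap_fset big_seq; apply: big_ind.
  - rewrite -(sigma_algebra_id (saG c)).
    exact: (@measurableT _ (g_sigma_algebraType (G c))).
  - move=> X Y; rewrite -(sigma_algebra_id (saG c)).
    exact: (@measurableI _ (g_sigma_algebraType (G c))).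
  - move=> i; rewrite !inE/= => /andP[iJ /eqP <-]; apply: FG; exact: JE.
have -> : \bigcap_(i in [set` J]) E i = \bigcap_(c in [set` (g @` J)%fset]) A c.
  apply/seteqP; split=> o Eo.
    move=> c _ i /=; rewrite !inE/= => /andP[iJ _]; exact: Eo.
  move=> i /= iJ; apply: (Eo (g i)) => /=; first exact: in_imfset.
  by rewrite !inE/= iJ eqxx.
rewrite indG => [|c _]; last exact: GA.
rewrite (partition_big_imfset _ g)/=; apply: eq_bigr => c _.
rewrite /A (inner c) => [|i]; last first.
  by rewrite !inE/= => /andP[iJ gi]; split=> //; exact: JE.
by rewrite [RHS]big_fset_condE.
Qed.

End regrouping.

Section random_elements.
Context {R : realType}.

Lemma measurable_entry a b (i : 'I_a) (j : 'I_b) :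
  measurable_fun [set: 'M[R]_(a, b)] (fun M : 'M[R]_(a, b) => M i j).
Proof.
move=> _ Y mY; apply: sub_sigma_algebra; exists (i, j) => //=.
by exists Y.
Qed.

Lemma measurable_l2norm n : measurable_fun [set: 'cV[R]_n] (@l2norm R n).
Proof.
apply: (measurableT_comp (f := @Num.sqrt R)
  (g := fun v : 'cV[R]_n => \sum_i v i 0 ^+ 2)).
  exact: continuous_measurable_fun (@sqrt_continuous R).
apply: measurable_sum => i.
by apply: measurable_funX; exact: measurable_entry.
Qed.

End random_elements.

Section atoms.
Context d (T : measurableType d) (R : realType) (P : probability T R).
Context (n m : nat) (x0 : {RV P >-> 'cV[R]_n}) (w : nat -> {RV P >-> 'cV[R]_n}).
Context (u : nat -> {RV P >-> 'cV[R]_m}) (xi : nat -> {RV P >-> bool}).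
Variable sigma : R.
Hypothesis hindep : mutually_independent P
  (tnth [tuple sigma_future u 0; sigma_future xi 0; sigma_history x0 w u 0]).
Hypothesis hxi_indep : mutually_independent P
  (fun t : nat => g_sigma_algebra_preimage (xi t)).
Hypothesis hu_indep : mutually_independent P
  (fun t : nat => g_sigma_algebra_preimage (u t)).
Hypothesis hu : forall t, isotropic_gaussian P sigma (u t).
Hypothesis m_gt0 : (0 < m)%N.

(* [(s, None)] indexes the variable [xi s], and [(s, Some i)] the [i]-th entry
   of [u s]. *)
Definition atom := (nat * option 'I_m)%type.

Definition atom_sigma (a : atom) : set_system T :=
  if a.2 is Some i then g_sigma_algebra_preimage (fun o => u a.1 o i 0)
  else g_sigma_algebra_preimage (xi a.1).

Lemma measurable_input s i : measurable_fun [set: T] (fun o => u s o i 0).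
Proof. by apply: (measurableT_comp (measurable_entry i 0)); exact: measurable_funP. Qed.

Lemma sub_sigma_algebra_atom a : sub_sigma_algebra_of (atom_sigma a).
Proof.
case: a => s [i|]; apply: sub_sigma_algebra_preimage => /=.
  exact: measurable_input.
exact: measurable_funP.
Qed.

Let block_sigma (b : nat + nat) : set_system T :=
  match b with
  | inl s => g_sigma_algebra_preimage (u s)
  | inr s => g_sigma_algebra_preimage (xi s)
  end.

Let block_indep : mutually_independent P block_sigma.
Proof.
pose g (b : nat + nat) : 'I_3 := if b is inl _ then inord 0 else inord 1.
apply: (mutually_independent_nested (g := g) _ _ hindep).
- move=> c; rewrite (tnth_nth (fun=> False)); case: c => -[|[|[|]]]//= _;
  exact: smallest_sigma_algebra.
- move=> b; rewrite (tnth_nth (fun=> False)).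
  case: b => s; rewrite /g inordK//= => E bE; apply: sub_sigma_algebra;
  by exists s.
- move=> c; have [c0|c0] := eqVneq c (inord 0).
    apply: (product_rule_reindex (h := inl)
      (h' := fun b => if b is inl s then s else 0%N)) => //.
    by move=> [s|s]//=; rewrite c0 => /eqP /(congr1 val); rewrite /= !inordK.
  (* The value [c = 2], that of the history, has no block over it, so the same reindexing covers it
     vacuously. *)
  apply: (product_rule_reindex (h := inr)
    (h' := fun b => if b is inr s then s else 0%N)) => //.
  by move=> [s|s]//=; rewrite eq_sym (negbTE c0).
Qed.

Lemma atom_indep : mutually_independent P atom_sigma.
Proof.
pose g (a : atom) : nat + nat := if a.2 is Some _ then inl a.1 else inr a.1.
apply: (mutually_independent_nested (g := g) _ _ block_indep).
- case=> s /=; apply: sigma_algebra_preimage; exact: sigma_algebra_measurable.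
- case=> s [i|] E//= [Y mY <-].
  exists ((fun M : 'cV[R]_m => M i 0) @^-1` Y) => //.
  by rewrite -[X in measurable X]setTI; exact: measurable_entry.
- case=> s.
    apply: (product_rule_reindex (h := fun i => (s, Some i))
      (h' := fun a => odflt (Ordinal m_gt0) a.2)) => //.
      by move=> [s' [i|]]//= /eqP[->].
    exact: (hu s).1.
  apply: (product_rule_reindex (h := fun s' : nat => (s', None))
    (h' := fun a => a.1)) => //.
  by move=> [s' [i|]].
Qed.

End atoms.

(** * Concentration on residue classes, energy of the inputs and attacks *)

Definition row_norm (R : realType) (l : nat) (v : 'rV[R]_l) : R :=
  Num.sqrt (\sum_e v 0 e ^+ 2).

Section windows.
Context d (T : measurableType d) (R : realType) (P : probability T R).
Context (m k : nat) (u : nat -> {RV P >-> 'cV[R]_m}) (xi : nat -> {RV P >-> bool}).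
Variables (sigma p : R).
Hypothesis indep_atom : mutually_independent P (atom_sigma u xi).
Hypothesis hxi_indep : mutually_independent P
  (fun t : nat => g_sigma_algebra_preimage (xi t)).
Hypothesis hxi : forall t, is_bernoulli P p (xi t).
Hypothesis hu : forall t, isotropic_gaussian P sigma (u t).
Hypothesis m_gt0 : (0 < m)%N.
Hypothesis sigma_gt0 : 0 < sigma.
Hypothesis p01 : 0 <= p <= 1.
Let q := 1 - (1 - p) ^+ (k - 1).
Hypothesis q2 : 2 * q < 1.
Local Notation F := (atom_sigma u xi).
Let saF := sub_sigma_algebra_atom u xi.

Lemma is_gauss_input s i : is_gauss P (fun o => u s o i 0) sigma.
Proof.
apply: is_gauss_law => //; first exact: measurable_input.
exact: (hu s).2.
Qed.

(* The window starting at [i] is observed at time [t = i + k - 1]. *)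
Definition window_input (v : 'rV[R]_(\sum_(j < k) m)) (i : nat) (o : T) : R :=
  \sum_e v 0 e * u (i + k.-1 - tagnat.sig1 e)%N o (tagnat.sig2 e) 0.

Lemma window_inputE v i o : window_input v i o =
  (v *m stacked_input k (fun t => u t o) (i + k.-1)) 0 0.
Proof. by rewrite mxE; apply: eq_bigr => e _; rewrite !mxE. Qed.

(** Beyond [x_i], the output at time [i + k - 1] involves the attacks at times [i, ..., i + k - 2],
    hence [k.-1] indicators although the window holds [k] inputs. *)
Definition attacked (i : nat) (o : T) : bool := has (fun s => xi s o) (iota i k.-1).

Let W (i : nat) : set (atom m) := [set a | (i <= a.1 < i + k)%N].

Lemma adapted_input s i :
  adapted (F (s, Some i)) (fun o => u s o i 0).
Proof. exact: adapted_preimage. Qed.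

Lemma is_gauss_window v i : is_gauss P (window_input v i) (sigma * row_norm v).
Proof.
apply: (is_gauss_sum saF indep_atom
  (al := fun e => ((i + k.-1 - tagnat.sig1 e)%N, Some (tagnat.sig2 e)))
  (fun e => v 0 e)
  (X := fun e o => u (i + k.-1 - tagnat.sig1 e)%N o (tagnat.sig2 e) 0)) => //.
- exact: ltW.
- rewrite map_inj_uniq ?index_enum_uniq// => e e' [e1 /(congr1 val) e2].
  have e1' : tagnat.sig1 e = tagnat.sig1 e'.
    (* For offsets below [k] the subtraction does not truncate, so different blocks of a window are
       inputs at different times. *)
    have inj a b : (a < k)%N -> (b < k)%N ->
      (i + k.-1 - a = i + k.-1 - b)%N -> a = b by clear; lia.
    by apply/val_inj; exact: inj (ltn_ord _) (ltn_ord _) e1.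
  apply/val_inj => /=; rewrite (tagnat.rect e) (tagnat.rect e') e1'.
  by congr (_ + _)%N.
- by move=> e; exact: adapted_input.
- by move=> e; exact: is_gauss_input.
Qed.

(** The inputs and the indicators of a window sit on disjoint sets of atoms; this is what makes the
    sign independent of the window input. *)
Let Wu i : set (atom m) := W i `&` [set a | a.2 != None].
Let Wx i : set (atom m) := W i `&` [set a | a.2 = None].

Lemma adapted_window v i : adapted (sigma_on F (Wu i)) (window_input v i).
Proof.
apply: adapted_sum; first exact: sub_sigma_algebra_on.
move=> e _; apply: (adapted_sub _ (adapted_input _ _)); apply: sigma_on_mem.
split=> //=; rewrite /W/=; have := ltn_ord (tagnat.sig1 e).
by move: (nat_of_ord _) => j; clear; lia.
Qed.

Lemma adapted_attacked i : adapted (sigma_on F (Wx i)) (attacked i).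
Proof.
have saW := sub_sigma_algebra_on saF (Wx i).
apply/(adapted_g_sigma _ saW).
have : {subset iota i k.-1 <= [pred s | (i <= s < i + k)%N]}.
  by move=> s; rewrite mem_iota inE; clear; lia.
rewrite /attacked; elim: (iota i k.-1) => [|s l ih] sl.
  exact: measurable_cst.
rewrite [X in measurable_fun _ X](_ : _ =
  (fun o => xi s o || has (fun s => xi s o) l)); last by apply/funext => o.
apply: measurable_or; last first.
  by apply: ih => s' s'l; apply: sl; rewrite inE s'l orbT.
apply/(adapted_g_sigma _ saW).
apply: (adapted_sub _ (@adapted_preimage _ _ _ _ (xi s))).
apply: (sigma_on_mem (F := F) (i := (s, None))).
by split=> //=; apply: sl; rewrite inE eqxx.
Qed.

Lemma prob_attacked i : P (attacked i @^-1` [set true]) = q%:E.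
Proof.
have mb := adapted_measurable (sub_sigma_algebra_on saF _) (@adapted_attacked i).
rewrite (_ : _ @^-1` _ = ~` (attacked i @^-1` [set false])); last first.
  by apply/seteqP; split=> o /=; case: (attacked i o).
rewrite probability_setC; last first.
  by rewrite -[X in measurable X]setTI; exact: mb.
rewrite /q EFinB; congr (_ - _)%E.
pose J := [fset s in iota i k.-1]%fset.
have -> : attacked i @^-1` [set false] =
    \bigcap_(s in [set` J]) (xi s @^-1` [set false]).
  apply/seteqP; split=> o /=.
    move=> /negbT/hasPn h s /=; rewrite !inE/= => /h; exact: negbTE.
  move=> h; apply/negbTE/hasPn => s si; apply/negbT; apply: (h s) => /=.
  by rewrite !inE.
rewrite hxi_indep => [|s _]; last by exists [set false] => //; rewrite setTI.
rewrite (eq_bigr (fun=> (1 - p)%:E)) => [|s _]; last first.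
  rewrite hxi bernoulli_probE// !diracE.
  by rewrite memNset// mem_set//= mule0 mule1 add0e.
rewrite prodEFin big_const_seq count_predT /J card_fseq undup_id ?iota_uniq//.
by rewrite size_iota iter_mulr_1 subn1.
Qed.


Definition signed_input v i o : R := (-1) ^+ attacked i o * `|window_input v i o|.

Lemma adapted_signed_comp v i (g : R -> R) (s : R) :
  measurable_fun [set: R] g -> adapted (sigma_on F (W i))
    (fun o => g ((-1) ^+ attacked i o * `|s * window_input v i o|)).
Proof.
move=> mg; apply/(adapted_g_sigma _ (sub_sigma_algebra_on saF _)).
have mw : measurable_fun [set: g_sigma_algebraType (sigma_on F (W i))]
    (window_input v i).
  apply/(adapted_g_sigma _ (sub_sigma_algebra_on saF _)).
  apply: (adapted_sub _ (@adapted_window v i)); apply: sigma_on_sub.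
  by move=> a [].
have mb : measurable_fun [set: g_sigma_algebraType (sigma_on F (W i))] (attacked i).
  apply/(adapted_g_sigma _ (sub_sigma_algebra_on saF _)).
  apply: (adapted_sub _ (@adapted_attacked i)); apply: sigma_on_sub.
  by move=> a [].
apply: (measurableT_comp mg); apply: measurable_funM.
  by apply: (measurableT_comp (f := fun b : bool => (-1) ^+ b : R)).
by apply: measurableT_comp => //; exact: measurable_funM.
Qed.

Lemma measurable_signed v i : measurable_fun [set: T] (signed_input v i).
Proof.
have := adapted_measurable (sub_sigma_algebra_on saF _)
  (@adapted_signed_comp v i id 1 (@measurable_id _ _ _)).
by rewrite /signed_input; under eq_fun do rewrite mul1r.
Qed.

(** For [c < k], the number of windows [i < N] congruent to [c] modulo [k]; the range [j < N] is
    merely large enough. *)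
Definition class_size (c N : nat) : nat := \sum_(j < N | (c + k * j < N)%N) 1.

(* The windows starting at [c], [c + k], [c + 2 k], ... are disjoint. *)
Lemma residue_class_tail v c N : (c < k)%N -> 0 < row_norm v ->
  (P [set o | (\sum_(j < N | (c + k * j < N)%N) signed_input v (c + k * j)%N o <=
      (class_size c N)%:R * ((1 - 2 * q) / 8) * (sigma * row_norm v))%R] <=
   (expR (- ((class_size c N)%:R * ((1 - 2 * q) ^+ 2 / 2 ^+ 15))))%:E)%E.
Proof.
move=> ck v0; set n := class_size c N; set kap := 1 - 2 * q; set s := sigma * row_norm v.
have kap0 : 0 < kap by rewrite subr_gt0.
have q0 : 0 <= q by rewrite -lee_fin -(prob_attacked 0) measure_ge0.
have s0 : 0 < s by rewrite mulr_gt0.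
(* The minimizer of [- l * kap / 8 + 128 * l^2], the exponent per window that remains between the
   mean [kap / 4] and the threshold [kap / 8]; its minimum is [- kap^2 / 2^15]. *)
pose l := kap / 2 ^+ 11.
have l0 : 0 < l by rewrite divr_gt0.
have l1 : l <= 1 by rewrite /l /kap; lra.
pose x i o : R := (-1) ^+ attacked i o * `|s^-1 * window_input v i o|.
have xE i o : s * x i o = signed_input v i o.
  rewrite /x /signed_input normrM gtr0_norm ?invr_gt0//.
  by rewrite mulrCA mulVKf// gt_eqF.
pose X o := \sum_(j < N | (c + k * j < N)%N) - l * x (c + k * j)%N o.
pose b := expR (- l * (kap / 4) + 128 * l ^+ 2).
have mX : measurable_fun [set: T] X.
  rewrite /X; under eq_fun do rewrite big_mkcond/=.
  apply: measurable_sum => j; case: (c + k * j < N)%N => //.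
  apply: measurable_funM => //.
  exact: (adapted_measurable (sub_sigma_algebra_on saF _)
    (@adapted_signed_comp v _ id s^-1 (@measurable_id _ _ _))).
have EX : (\int[P]_o (expR (X o))%:E <= (b ^+ n)%:E)%E.
  rewrite /X; under eq_integral do rewrite expR_sum.
  apply: (integral_prod_blocks saF indep_atom (J := fun j => W (c + k * j)%N)
    (Q := fun j => (c + k * j < N)%N)
    (f := fun j o => expR (- l * x (c + k * j)%N o))) => [i j ij|j|j o|j _].
  - rewrite -subset0 => a [] /=; rewrite /W/=; clear -ij.
    have : (k + k * i <= k * j)%N.
      by rewrite -mulnS leq_mul2l; case/andP: ij => ->; rewrite orbT.
    lia.
  - apply: (@adapted_signed_comp v _ (fun y => expR (- l * y))).
    by apply: measurableT_comp => //; exact: measurable_funM.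
  - exact: expR_ge0.
  apply: (integral_signed_abs (sub_sigma_algebra_on saF (Wx (c + k * j)))
    (sub_sigma_algebra_on saF (Wu (c + k * j))) (q := q)).
  - apply: indep_sigma_on => //; rewrite -subset0 => a [[_ /= a1] [_ /=]].
    by rewrite a1.
  - exact: adapted_attacked.
  - apply/(adapted_g_sigma _ (sub_sigma_algebra_on saF _)).
    apply: measurable_funM => //.
    by apply/(adapted_g_sigma _ (sub_sigma_algebra_on saF _)); exact: adapted_window.
  - have := is_gaussZ s^-1 (@is_gauss_window v (c + k * j)%N).
    by rewrite mulVf// gt_eqF.
  - exact: prob_attacked.
  - exact: ltW.
  - by rewrite ltW.
have := chernoff_bound (- l * (n%:R * (kap / 8))) mX EX.
rewrite (_ : [set o | _] = [set o | \sum_(j < N | (c + k * j < N)%N)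
    signed_input v (c + k * j)%N o <= n%:R * (kap / 8) * s]); last first.
  apply/seteqP; split=> o /=; rewrite /X -mulr_sumr.
    rewrite !mulNr lerN2 ler_pM2l// => h.
    under eq_bigr do rewrite -xE.
    by rewrite -mulr_sumr mulrC ler_pM2r.
  under eq_bigr do rewrite -xE.
  by rewrite -mulr_sumr mulrC ler_pM2r// !mulNr lerN2 ler_pM2l.
move=> /le_trans; apply; rewrite lee_fin /b -expRM_natl -expRD ler_expR.
rewrite -subr_ge0 /l le_eqVlt; apply/orP; left; apply/eqP.
by field.
Qed.

(** Each of the [m * M] entries contributes the mean [sqrt 2] of [expR (g^2 / 4)] for a standard
    Gaussian [g]; independence is used over the entries of one input, then over time. *)
Lemma input_exp_moment M :
  (\int[P]_o (expR (\sum_(s < M) l2norm (u s o) ^+ 2 / (4 * sigma ^+ 2)))%:E <=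
   ((Num.sqrt 2 ^+ m) ^+ M)%:E)%E.
Proof.
pose sq s i o := expR (u s o i 0 ^+ 2 / (4 * sigma ^+ 2)).
have sq_adapted s i : adapted (F (s, Some i)) (sq s i).
  have mexp : measurable_fun [set: R] (fun x => expR (x ^+ 2 / (4 * sigma ^+ 2))).
    by apply: measurableT_comp => //; apply: measurable_funM.
  exact: (adapted_comp mexp (@adapted_input s i)).
have Esq s i : (\int[P]_o (sq s i o)%:E <= (Num.sqrt 2)%:E)%E.
  rewrite (is_gauss_input s i (f := fun x => (expR (x ^+ 2 / (4 * sigma ^+ 2)))%:E)).
  - under eq_integral => x _.
      rewrite (_ : _ / _ = 4^-1 * x ^+ 2); last by field; rewrite gt_eqF.
      over.
    rewrite integral_expR_sqr; last by lra.
    rewrite (_ : 1 - 2 * 4^-1 = 2^-1); last by field.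
    by rewrite sqrtrV ?ler0n// invrK.
  - by apply/measurable_EFinP; apply: measurableT_comp => //; exact: measurable_funM.
  - by move=> x; rewrite lee_fin expR_ge0.
pose d0 := Ordinal m_gt0.
(* [integral_prod_blocks] is indexed by natural numbers; for [i < m] the default [d0] does not
   intervene. *)
pose row s o := \prod_(i < m) sq s (insubd d0 (i : nat)) o.
have rowE s o : expR (l2norm (u s o) ^+ 2 / (4 * sigma ^+ 2)) = row s o.
  rewrite /l2norm sqr_sqrtr; last by apply: sumr_ge0 => i _; exact: sqr_ge0.
  by rewrite mulr_suml expR_sum; apply: eq_bigr => i _; rewrite valKd.
have Erow s : (\int[P]_o (row s o)%:E <= (Num.sqrt 2 ^+ m)%:E)%E.
  have := @integral_prod_blocks _ _ _ P _ _ saF indep_atom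
    (fun i => [set (s, Some (insubd d0 i))]) xpredT
    (fun i => sq s (insubd d0 i)) (Num.sqrt 2) m.
  rewrite sum1_card card_ord; apply => [i j /andP[ij jm]|i|i o|i _].
  - rewrite -subset0 => a [/= -> [/(congr1 val)]].
    by rewrite /= !val_insubd jm (ltn_trans ij jm) => /eqP; rewrite ltn_eqF.
  - apply: (adapted_sub _ (@sq_adapted _ _)); exact: sigma_on_mem.
  - exact: expR_ge0.
  - exact: Esq.
under eq_integral do rewrite expR_sum.
under eq_integral do under eq_bigr do rewrite rowE.
have := @integral_prod_blocks _ _ _ P _ _ saF indep_atom
  (fun s => [set a | a.1 = s]) xpredT row (Num.sqrt 2 ^+ m) M.
rewrite sum1_card card_ord; apply => [i j /andP[ij _]|s|s o|s _].
- by rewrite -subset0 => a [/= -> /eqP]; rewrite ltn_eqF.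
- apply/(adapted_g_sigma _ (sub_sigma_algebra_on saF _)).
  apply: measurable_prod => i _.
  apply/(adapted_g_sigma _ (sub_sigma_algebra_on saF _)).
  apply: (adapted_sub _ (@sq_adapted _ _)); exact: sigma_on_mem.
- by apply: prodr_ge0 => i _; exact: expR_ge0.
- exact: Erow.
Qed.

End windows.

(** * Exponential moment of the attacks *)

Section attacks.
Context d (T : measurableType d) (R : realType) (P : probability T R).
Context (n : nat) (x0 : {RV P >-> 'cV[R]_n}) (w : nat -> {RV P >-> 'cV[R]_n}).
Variable eta : R.
Hypothesis eta_gt0 : 0 < eta.
Hypothesis hx0 : (psi2_norm P (fun o => l2norm (x0 o)) <= eta%:E)%E.
Hypothesis hw : forall t, cond_psi2_le P (sigma_attacks x0 w t)
  (fun o => l2norm (w t o)) eta.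
Local Open Scope ereal_scope.

(** The initial state carries an extra factor 4 because its norm is an infimum that is not known to
    be attained: some scale below [2 * eta] is admissible. For the attacks the bound holds at the
    scale [eta] itself. *)
Definition attack_energy (t : nat) (o : T) : R :=
  (l2norm (x0 o) ^+ 2 / (4 * eta ^+ 2) +
   \sum_(s < t) l2norm (w s o) ^+ 2 / eta ^+ 2)%R.

Lemma sub_sigma_algebra_attacks t : sub_sigma_algebra_of (sigma_attacks x0 w t).
Proof.
apply: sub_sigma_algebra_g => E [|[s _]] [Y mY <-]; exact: measurable_funP.
Qed.

Lemma adapted_attack_energy t : adapted (sigma_attacks x0 w t) (attack_energy t).
Proof.
have saA := sub_sigma_algebra_attacks t.
apply/(adapted_g_sigma _ saA).
have l2A (z : T -> 'cV[R]_n) : g_sigma_algebra_preimage z `<=` sigma_attacks x0 w t ->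
    measurable_fun [set: g_sigma_algebraType (sigma_attacks x0 w t)]
      (fun o => l2norm (z o)).
  move=> zA; apply/(adapted_g_sigma _ saA); apply: (adapted_sub zA).
  exact: (adapted_comp (@measurable_l2norm _ _) (@adapted_preimage _ _ _ _ z)).
apply: measurable_funD.
  apply: measurable_funM => //; apply: measurable_funX; apply: l2A.
  by move=> E x0E; apply: sub_sigma_algebra; left.
apply: measurable_sum => s; apply: measurable_funM => //; apply: measurable_funX.
apply: l2A => E wE; apply: sub_sigma_algebra; right.
by exists (s : nat) => //=; exact: ltn_ord.
Qed.

(** The energy up to time [t] is adapted to [sigma_attacks x0 w t], so the factor of [w t] may be
    replaced by the version [g], almost surely at most 2. Each step costs a factor 2, however the
    attacks depend on one another. *)
Lemma attack_exp_moment t :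
  \int[P]_o (expR (attack_energy t o))%:E <= (2 ^+ t.+1)%:E.
Proof.
have ml2 (z : {RV P >-> 'cV[R]_n}) (c : R) : measurable_fun [set: T]
    (fun o => (expR (l2norm (z o) ^+ 2 / c))%:E).
  apply/measurable_EFinP; apply: measurableT_comp => //.
  apply: measurable_funM => //; apply: measurable_funX.
  apply: (measurableT_comp (@measurable_l2norm _ _)); exact: measurable_funP.
elim: t => [|t ih].
  rewrite expr1 /attack_energy; under eq_integral do rewrite big_ord0 addr0.
  have : psi2_norm P (fun o => l2norm (x0 o)) < (2 * eta)%:E.
    by apply: le_lt_trans hx0 _; rewrite lte_fin ltr_pMl// ltr1n.
  move=> /ereal_inf_lt[_ [s [s0 Es] <-]]; rewrite lte_fin => s2.
  apply: le_trans Es; rewrite unlock; apply: ge0_le_integral => //.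
  have s0' : (0 < s)%R by exact: s0.
  have s2' : (0 < s ^+ 2 <= 4 * eta ^+ 2)%R by apply/andP; split; nra.
  move=> o _; rewrite lee_fin ler_expR ler_wpM2l ?sqr_ge0//.
  by case/andP: s2' => s20 s2'; rewrite lef_pV2// posrE (lt_le_trans s20).
have saA := sub_sigma_algebra_attacks t.
have [g [[gA g0 gE] g2]] := hw t.
have mg : measurable_fun [set: T] g by exact: (adapted_measurable saA gA).
under eq_integral => o _.
  rewrite /attack_energy big_ord_recr/= addrA expRD EFinM.
  over.
have mexp : measurable_fun [set: R] (fun x : R => (expR x)%:E).
  by apply/measurable_EFinP.
have MA := adapted_comp mexp (@adapted_attack_energy t).
have M0 o : 0 <= (expR (attack_energy t o))%:E by rewrite lee_fin expR_ge0.
rewrite -(ge0_integral_adapted (mu1 := P) mg (ml2 (w t) _) g0 _ saA gE MA M0).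
  apply: (@le_trans _ _ (\int[P]_o ((expR (attack_energy t o))%:E * 2%:E))).
    apply: ae_ge0_le_integral => //.
    - by move=> o _; apply: mule_ge0; [exact: M0|exact: g0].
    - by apply: emeasurable_funM => //; exact: (adapted_measurable saA MA).
    - by apply: emeasurable_funM => //; exact: (adapted_measurable saA MA).
    by apply: filterS g2 => o go _; apply: lee_wpmul2l => //; exact: M0.
  rewrite ge0_integralZr//; last exact: (adapted_measurable saA MA).
  by rewrite exprSr EFinM lee_wpmul2r// lee_fin.
by move=> o; rewrite lee_fin expR_ge0.
Qed.

End attacks.

(** * From the grid to all row vectors *)

Lemma sum_residues (V : nmodType) (k N : nat) (g : nat -> V) : (0 < k)%N ->
  \sum_(i < N) g i =
  \sum_(c < k) \sum_(j < N | (c + k * j < N)%N) g (c + k * j)%N.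
Proof.
move=> k0; rewrite pair_big_dep/=.
case: N g => [|N] g; first by rewrite big_ord0 big_pred0// => -[c []].
pose h (i : 'I_N.+1) : 'I_k * 'I_N.+1 :=
  (Ordinal (ltn_pmod i k0), Ordinal (leq_ltn_trans (leq_div i k) (ltn_ord i))).
pose h' (a : 'I_k * 'I_N.+1) : 'I_N.+1 := inord (a.1 + k * a.2).
have hK i : ((h i).1 + k * (h i).2 = i :> nat)%N.
  by rewrite [RHS](divn_eq i k) /h/= addnC mulnC.
rewrite (reindex_onto h h')/=; last first.
  move=> [c j] /= cj; have jE : h' (c, j) = (k * j + c)%N :> nat.
    by rewrite /h' inordK //= addnC.
  congr pair; apply/val_inj; rewrite /= jE mulnC.
    by rewrite modnMDl modn_small.
  by rewrite divnMDl// divn_small// addn0.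
rewrite big_mkcond [RHS]big_mkcond; apply: eq_bigr => i _ /=.
have hi := hK i; rewrite /= in hi.
rewrite hi ltn_ord/= (_ : h' (h i) == i) ?andbT//.
by rewrite /h' hK inord_val.
Qed.

Lemma sum_shift_le (R : realDomainType) (a : nat -> R) (b N M : nat) :
  (N + b <= M)%N -> (forall s, 0 <= a s) ->
  \sum_(i < N) a (i + b)%N <= \sum_(s < M) a s.
Proof.
move=> NM a0; rewrite -(big_mkord xpredT (fun i => a (i + b)%N)).
have -> : \sum_(0 <= i < N) a (i + b)%N = \sum_(b <= i < N + b) a i.
  by rewrite -{2}[b]add0n big_addn addnK.
rewrite -(big_mkord xpredT a) [leRHS](@big_cat_nat _ _ _ (N + b)%N)//=.
rewrite (@big_cat_nat _ _ _ b 0 (N + b)%N) ?leq_addl//=.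
have : 0 <= \sum_(0 <= i < b) a i by exact: sumr_ge0.
have : 0 <= \sum_(N + b <= i < M) a i by exact: sumr_ge0.
lra.
Qed.

Section grid.
Context d (T : measurableType d) (R : realType) (P : probability T R).
Context (m k : nat) (u : nat -> {RV P >-> 'cV[R]_m}) (xi : nat -> {RV P >-> bool}).
Variables (sigma kap : R) (N : nat) (o : T).
Hypothesis m_gt0 : (0 < m)%N.
Hypothesis k_gt1 : (1 < k)%N.
Hypothesis sigma_gt0 : 0 < sigma.
Hypothesis kap01 : 0 < kap <= 1.
Hypothesis kN : (k <= N)%N.

Local Notation D := (\sum_(j < k) m)%N.
Local Notation signed v i := (signed_input u xi v i o).

Hypothesis energy :
  \sum_(s < N + k.-1) l2norm (u s o) ^+ 2 <= 8 * sigma ^+ 2 * (N * m)%N%:R.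

Lemma dimE : D = (k * m)%N.
Proof. by rewrite sum_nat_const card_ord. Qed.

Let abs_row s := \sum_l `|u s o l 0|.

(** Sum [|z| <= z^2 / (2 sigma) + sigma / 2]: the energy contributes [4] and, as [N + k - 1 <= 2 N],
    the constant part at most [1]. *)
Let sum_abs_row : \sum_(s < N + k.-1) abs_row s <= 5 * sigma * (N * m)%N%:R.
Proof.
have row_le s : abs_row s <= l2norm (u s o) ^+ 2 / (2 * sigma) + sigma / 2 * m%:R.
  rewrite /l2norm sqr_sqrtr; last by apply: sumr_ge0 => i _; exact: sqr_ge0.
  have -> : sigma / 2 * m%:R = \sum_(l < m) (sigma / 2).
    by rewrite sumr_const card_ord mulr_natr.
  rewrite mulr_suml -big_split/=.
  apply: ler_sum => l _; move: (u s o l 0) => z.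
  rewrite -[z ^+ 2]real_normK ?num_real//; move: `|z| => {}z.
  rewrite -subr_ge0 (_ : _ - _ = (z - sigma) ^+ 2 / (2 * sigma)).
    by rewrite divr_ge0 ?sqr_ge0// mulr_ge0// ltW.
  by field; rewrite gt_eqF.
have := @ler_sum _ _ (index_enum 'I_(N + k.-1)) xpredT _ _
  (fun s _ => row_le (s : nat)).
move=> /le_trans; apply.
rewrite big_split/= -mulr_suml sumr_const card_ord.
have h1 : (\sum_(i < N + k.-1) l2norm (u i o) ^+ 2) / (2 * sigma) <=
    4 * sigma * (N * m)%N%:R.
  rewrite ler_pdivrMr ?mulr_gt0//; apply: le_trans energy _.
  by rewrite le_eqVlt; apply/orP; left; apply/eqP; ring.
have h2 : sigma / 2 * m%:R *+ (N + k.-1) <= sigma * (N * m)%N%:R.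
  have le2N : (N + k.-1)%N%:R <= 2 * N%:R :> R.
    have : (N + k.-1 <= 2 * N)%N by move: kN k_gt1; clear; lia.
    by rewrite -natrM ler_nat.
  have sm0 : 0 <= sigma * m%:R by rewrite mulr_ge0// ltW.
  have h := ler_wpM2l sm0 le2N.
  rewrite -mulr_natr natrM -subr_ge0.
  rewrite (_ : _ - _ = (sigma * m%:R * (2 * N%:R) - sigma * m%:R * (N + k.-1)%N%:R) / 2).
    by rewrite divr_ge0// subr_ge0.
  by field.
lra.
Qed.

(** For each of the [k] offsets [j], the times [i + k - 1 - j] are distinct and below [N + k - 1],
    so every input is counted at most [k] times. *)
Lemma sum_window_abs : \sum_(i < N) \sum_e
    `|u (i + k.-1 - tagnat.sig1 (e : 'I_D))%N o (tagnat.sig2 e) 0| <=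
  5 * sigma * N%:R * D%:R.
Proof.
have row_split i : \sum_e `|u (i + k.-1 - tagnat.sig1 (e : 'I_D))%N o (tagnat.sig2 e) 0| =
    \sum_(j < k) abs_row (i + k.-1 - j)%N.
  rewrite (reindex (fun a : 'I_k * 'I_m => tagnat.Rank a.1 a.2 : 'I_D))/=; last first.
    exists (fun e => (tagnat.sig1 e, tagnat.sig2 e)) => [[j l]|e] _ /=.
      congr pair; apply/val_inj; rewrite /= ?tagnat.Rank1K//.
      by rewrite tagnat.Rank2K.
    by rewrite tagnat.sig2K.
  rewrite /abs_row (pair_bigA _ (fun (j : 'I_k) (l : 'I_m) =>
    `|u (i + k.-1 - j)%N o l 0|))/=.
  apply: eq_bigr => a _; rewrite tagnat.Rank1K; congr `|u _ o _ 0|.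
  by apply/val_inj; rewrite tagnat.Rank2K.
under eq_bigr do rewrite row_split.
rewrite exchange_big/=.
have shift (j : 'I_k) : \sum_(i < N) abs_row (i + k.-1 - j)%N <=
    \sum_(s < N + k.-1) abs_row s.
  have jk := ltn_ord j.
  under eq_bigr do rewrite -addnBA -1?ltnS ?prednK ?(ltnW k_gt1)//.
  apply: sum_shift_le => [|s]; first by rewrite leq_add2l leq_subr.
  by apply: sumr_ge0.
have := @ler_sum _ _ (index_enum 'I_k) xpredT _ _
  (fun j _ => le_trans (shift j) sum_abs_row).
move=> /le_trans; apply.
rewrite sumr_const card_ord dimE -mulr_natr !natrM.
by rewrite le_eqVlt; apply/orP; left; apply/eqP; ring.
Qed.

Lemma window_inputB (v v' : 'rV[R]_D) i :
  window_input u (v - v') i o = window_input u v i o - window_input u v' i o.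
Proof.
rewrite /window_input -sumrB; apply: eq_bigr => e _.
by rewrite !mxE mulrBl.
Qed.

Lemma signed_inputZ c (v : 'rV[R]_D) i : signed (c *: v) i = `|c| * signed v i.
Proof.
rewrite /signed_input mulrCA -normrM; congr (_ * `|_|).
by rewrite /window_input mulr_sumr; apply: eq_bigr => e _; rewrite mxE mulrA.
Qed.

Lemma signed_input_near h (v v' : 'rV[R]_D) i : (forall e, `|v 0 e - v' 0 e| <= h) ->
  signed v' i - h * \sum_e
    `|u (i + k.-1 - tagnat.sig1 (e : 'I_D))%N o (tagnat.sig2 e) 0| <= signed v i.
Proof.
move=> vv'; rewrite lerBlDr -lerBlDl /signed_input -mulrBr.
set a := window_input u v' i o; set b := window_input u v i o.
apply: (@le_trans _ _ `|b - a|).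
  have := ler_dist_dist b a; rewrite ler_norml => /andP[h1 h2].
  by case: (attacked _ _ _ _); rewrite ?expr1 ?expr0 ?mulN1r ?mul1r; lra.
rewrite /a /b -window_inputB mulr_sumr; apply: le_trans (ler_norm_sum _ _ _) _.
apply: ler_sum => e _; rewrite normrM ler_wpM2r// !mxE; exact: vv'.
Qed.

(** The grid of mesh [1 / L] in the cube [[-1, 1]^D]. The points need not have norm 1: the tail
    bound is relative to [row_norm]. *)
Definition grid_point (L : nat) (g : {ffun 'I_D -> 'I_(2 * L).+1}) : 'rV[R]_D :=
  \row_e (((g e)%:R - L%:R) / L%:R).

Lemma grid_point_near L (v : 'rV[R]_D) : (0 < L)%N -> (forall e, `|v 0 e| <= 1) ->
  exists g, forall e, `|v 0 e - grid_point (L := L) g 0 e| <= L%:R^-1.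
Proof.
move=> L0 v1; have L0' : 0 < L%:R :> R by rewrite ltr0n.
exists [ffun e => inord (Num.truncn (L%:R * (v 0 e + 1)))] => e.
have := v1 e; rewrite ler_norml !mxE ffunE => /andP[vl vr].
set x := L%:R * (v 0 e + 1).
have x0 : 0 <= x by rewrite mulr_ge0 ?(ltW L0')//; lra.
have /andP[x1 x2] := truncn_itv x0.
have xL : x <= (2 * L)%N%:R by rewrite /x natrM mulrC ler_wpM2r ?(ltW L0')//; lra.
rewrite inordK; last by rewrite ltnS -(ler_nat R); exact: le_trans xL.
have -> : v 0 e = (x - L%:R) / L%:R by rewrite /x; field; rewrite gt_eqF.
rewrite -mulrBl normrM (gtr0_norm (_ : 0 < L%:R^-1)) ?invr_gt0//.
rewrite -[leRHS]mul1r ler_pM2r ?invr_gt0// ler_norml.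
move: x2; rewrite -natr1; lra.
Qed.

(** The size of [L] keeps [y = D / L] below [kap / 96]. Moving from a unit vector to a grid point
    loses at most [5 y] (times [N sigma]) in the sum and [2 y] in the norm, and
    [kap / 8 * (1 - 2 y) - 5 y >= kap / 16]. *)
Lemma grid_lower_bound (L : nat) : 96 * (D%:R / kap) <= L%:R ->
  (forall g : {ffun 'I_D -> 'I_(2 * L).+1}, 0 < row_norm (grid_point g) ->
    N%:R * (kap / 8) * (sigma * row_norm (grid_point g)) <=
    \sum_(i < N) signed (grid_point g) i) ->
  forall v : 'rV[R]_D, N%:R * (kap * sigma / 16) * row_norm v <=
    \sum_(i < N) signed v i.
Proof.
case/andP: kap01 => kap0 kap1 hL hg v.
have D0 : (0 < D)%N by rewrite dimE muln_gt0 (ltnW k_gt1).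
have D0' : 0 < D%:R :> R by rewrite ltr0n.
have L0' : 0 < L%:R :> R.
  by apply: lt_le_trans hL; rewrite !mulr_gt0// invr_gt0.
have L0 : (0 < L)%N by rewrite -(ltr0n R).
wlog v1 : v / row_norm v = 1.
  move=> H; have [v0|v0] := leP (row_norm v) 0.
    have vE e : v 0 e = 0.
      have : row_norm v = 0 by apply/le_anti; rewrite v0 sqrtr_ge0.
      move=> /eqP; rewrite sqrtr_eq0 => h.
      have : v 0 e ^+ 2 <= 0.
        apply: le_trans h; rewrite (bigD1 e)//= lerDl.
        by apply: sumr_ge0 => *; exact: sqr_ge0.
      by rewrite real_exprn_even_le0//= => /eqP.
    apply: (@le_trans _ _ 0).
      rewrite mulr_ge0_le0// !mulr_ge0// ?ltW//.
    apply: sumr_ge0 => i _; rewrite /signed_input /window_input big1 ?normr0 ?mulr0//.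
    by move=> e _; rewrite vE mul0r.
  have vv : v = row_norm v *: ((row_norm v)^-1 *: v).
    by rewrite scalerA divff ?scale1r// gt_eqF.
  have n1 : row_norm ((row_norm v)^-1 *: v) = 1.
    rewrite {1}/row_norm; under eq_bigr do rewrite mxE exprMn.
    rewrite -mulr_sumr sqrtrM ?sqr_ge0// sqrtr_sqr gtr0_norm ?invr_gt0//.
    by rewrite mulVf// gt_eqF.
  have := H _ n1; rewrite n1 mulr1 => h.
  rewrite [in leRHS]vv; under [leRHS]eq_bigr do rewrite signed_inputZ.
  by rewrite -mulr_sumr gtr0_norm// mulrC ler_wpM2l// ltW.
have s1 : \sum_e v 0 e ^+ 2 = 1.
  rewrite -[LHS]sqr_sqrtr; last by apply: sumr_ge0 => *; exact: sqr_ge0.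
  by rewrite -/(row_norm v) v1 expr1n.
have ve1 e : `|v 0 e| <= 1.
  rewrite -[leRHS]sqrtr1 -sqrtr_sqr ler_wsqrtr// -s1 (bigD1 e)//= lerDl.
  by apply: sumr_ge0 => *; exact: sqr_ge0.
have [g vg] := grid_point_near L0 ve1.
set h := (L%:R)^-1 in vg; set w := grid_point g in vg.
have h0 : 0 < h by rewrite invr_gt0.
pose y := h * D%:R.
have y0 : 0 <= y by rewrite mulr_ge0 ?ltW.
have yk : 96 * y <= kap.
  rewrite /y /h mulrCA mulrC ler_pdivrMr//.
  by move: hL; rewrite mulrA ler_pdivrMr// mulrC [L%:R * _]mulrC.
have w1 : 1 - 2 * y <= row_norm w.
  have w2 : 1 - 2 * y <= \sum_e w 0 e ^+ 2.
    have -> : 1 - 2 * y = \sum_e (v 0 e ^+ 2 - 2 * h).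
      by rewrite sumrB s1 sumr_const card_ord -[_ *+ D]mulr_natr /y mulrA.
    apply: ler_sum => e _; have := vg e; have := ve1 e; rewrite !ler_norml.
    move: (v 0 e) (w 0 e) => a b /andP[a1 a2] /andP[b1 b2].
    have ab : a * (a - b) <= h by have [d0|d0] := leP 0 (a - b); nra.
    have := sqr_ge0 (a - b); nra.
  (* As [0 <= 1 - 2 y <= 1], this number dominates its own square, so the bound on the squared norm
     passes to the norm. *)
  rewrite -[1 - 2 * y]ger0_norm; last by lra.
  rewrite -sqrtr_sqr ler_wsqrtr//; apply: le_trans w2; nra.
have wpos : 0 < row_norm w by apply: lt_le_trans w1; lra.
rewrite v1 mulr1.
apply: (@le_trans _ _ (\sum_(i < N) (signed w i - h * \sum_e
    `|u (i + k.-1 - tagnat.sig1 (e : 'I_D))%N o (tagnat.sig2 e) 0|))); last first.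
  by apply: ler_sum => i _; exact: signed_input_near.
rewrite sumrB -mulr_sumr.
have S1 := hg g wpos; rewrite -/w in S1.
have S2 := ler_wpM2l (ltW h0) sum_window_abs.
apply: le_trans (lerB S1 S2).
have N0 : 0 <= N%:R :> R by exact: ler0n.
have Ns : 0 <= N%:R * sigma by rewrite mulr_ge0// ltW.
have -> : h * (5 * sigma * N%:R * D%:R) = N%:R * sigma * (5 * y) by rewrite /y; ring.
have -> : N%:R * (kap / 8) * (sigma * row_norm w) =
  N%:R * sigma * (kap / 8 * row_norm w) by ring.
have -> : N%:R * (kap * sigma / 16) = N%:R * sigma * (kap / 16) by ring.
rewrite -mulrBr ler_wpM2l//.
nra.
Qed.

End grid.

(** * The event *)

Section numerics.
Context {R : realType}.

Lemma ln2_ge : 2^-1 <= ln 2 :> R.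
Proof.
rewrite -[leLHS]expRK ler_ln ?posrE ?expR_gt0//.
by have := @expRM1B_le1 R 2^-1; lra.
Qed.

Variables (k m N : nat) (kap delta : R).
Hypotheses (k_gt1 : (1 < k)%N) (m_gt0 : (0 < m)%N).
Hypotheses (kap01 : 0 < kap <= 1) (delta01 : 0 < delta <= 1).
Let D := (k * m)%N.
Let beta := D%:R / kap.
Let A := D%:R * ln beta + ln (1 / delta).
Hypothesis hN : 2 ^+ 20 * (k%:R / kap ^+ 2) * A <= N%:R.

Let kap0 : 0 < kap. Proof. by case/andP: kap01. Qed.
Let kap1 : kap <= 1. Proof. by case/andP: kap01. Qed.
Let delta0 : 0 < delta. Proof. by case/andP: delta01. Qed.
Let delta1 : delta <= 1. Proof. by case/andP: delta01. Qed.

Let kD : (k <= D)%N. Proof. by rewrite leq_pmulr. Qed.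
Let D2 : 2 <= D%:R :> R.
Proof. by rewrite ler_nat (leq_trans k_gt1). Qed.

Let Dbeta : D%:R <= beta.
Proof. by rewrite ler_pdivlMr// ler_piMr. Qed.

Let beta2 : 2 <= beta. Proof. exact: le_trans Dbeta. Qed.
Let beta0 : 0 < beta. Proof. exact: lt_le_trans beta2. Qed.
Let beta1 : 1 <= beta. Proof. by apply: le_trans beta2; rewrite ler1n. Qed.

Let lnbeta : 2^-1 <= ln beta.
Proof. by apply: le_trans ln2_ge _; rewrite ler_ln ?posrE. Qed.

Let lndelta : 0 <= ln (1 / delta).
Proof. by rewrite ln_ge0// div1r invf_ge1. Qed.

Let A1 : 1 <= A.
Proof.
have : 2 * 2^-1 <= D%:R * ln beta by rewrite ler_pM// invr_ge0.
by rewrite divff//; have := lndelta; rewrite /A; lra.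
Qed.

(** The budget for a single failure. It is at most [beta ^- (16 * D) * delta], of which
    [beta ^+ (10 * D)] pays for the union bound; the rest yields the factor [1/3]. *)
Let Q := expR (- (16 * A)).

Let k_kap : 1 <= k%:R / kap ^+ 2.
Proof.
rewrite ler_pdivlMr ?exprn_gt0// mul1r (@le_trans _ _ 1)//.
  by rewrite exprn_ile1// ltW.
by rewrite ler1n ltnW.
Qed.

Lemma sample_size_ge_order : (k <= N)%N.
Proof.
rewrite -(ler_nat R); apply: le_trans hN.
have : k%:R <= k%:R / kap ^+ 2.
  by rewrite ler_pdivlMr ?exprn_gt0// ler_piMr// exprn_ile1// ltW.
move=> /le_trans; apply; rewrite mulrAC ler_peMl ?(le_trans _ k_kap)//.
by rewrite mulr_ege1// exprn_ege1// ler1n.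
Qed.

Lemma expRN_sample_size : expR (- N%:R) <= Q.
Proof.
rewrite ler_expR lerN2; apply: le_trans hN.
rewrite ler_pM2r ?(lt_le_trans _ A1)//.
have -> : 16 = 2 ^+ 4 * 1 :> R by ring.
by rewrite ler_pM// ?exprn_ge0// ler_weXn2l// ler1n.
Qed.

(** Since [k <= N], the quotient [N %/ k] is at least [N / (2 k)]. The constant [2^20] originates
    here, as [2 * 2^15 * 16]: this halving, the Chernoff exponent, and the [16] of the budget. *)
Lemma expRN_class_size n : (N %/ k <= n)%N ->
  expR (- (n%:R * (kap ^+ 2 / 2 ^+ 15))) <= Q.
Proof.
move=> Nn; rewrite ler_expR lerN2.
have kN := sample_size_ge_order.
have k0 : 0 < k%:R :> R by rewrite ltr0n ltnW.
have n2 : N%:R <= 2 * k%:R * n%:R :> R.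
  have : (N <= 2 * k * (N %/ k))%N.
    have q0 : (0 < N %/ k)%N by rewrite divn_gt0 ?(ltnW k_gt1).
    have := divn_eq N k; have := ltn_pmod N (ltnW k_gt1); move: q0; clear; nia.
  move=> /leq_trans /(_ (leq_mul (leqnn (2 * k)) Nn)).
  by rewrite -(ler_nat R) !natrM.
have k2 : 0 < kap ^+ 2 by rewrite exprn_gt0.
have := le_trans hN n2.
have -> : 2 ^+ 20 * (k%:R / kap ^+ 2) * A = 2 * k%:R * (2 ^+ 15 * (16 * A) / kap ^+ 2).
  by field; rewrite gt_eqF.
rewrite ler_pM2l ?mulr_gt0// ler_pdivrMr// => h.
by rewrite mulrA ler_pdivlMr ?exprn_gt0// mulrC.
Qed.

Let QE : Q <= beta ^- (16 * D) * delta.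
Proof.
have e1 : expR (- (D%:R * ln beta)) = beta ^- D.
  by rewrite expRN expRM_natl lnK ?posrE.
have e2 : expR (- ln (1 / delta)) = delta.
  by rewrite expRN lnK ?posrE ?divr_gt0// div1r invrK.
rewrite /Q /A -mulrN opprD mulrDr expRD.
rewrite !expRM_natl e1 e2 -exprVn -exprM mulnC exprVn.
rewrite ler_wpM2l ?invr_ge0 ?exprn_ge0 ?(ltW beta0)//.
by rewrite -[leRHS]expr1 ler_wiXn2l// ltW.
Qed.

Let beta_pow n : beta ^+ n * beta ^- n = 1.
Proof. by rewrite divff// expf_neq0// gt_eqF. Qed.

Lemma expRN_failure : Q <= delta / 3.
Proof.
apply: le_trans QE _; rewrite mulrC ler_wpM2l ?(ltW delta0)//.
rewrite lef_pV2 ?posrE ?exprn_gt0//.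
apply: (@le_trans _ _ (2 ^+ 2)); first by lra.
apply: (@le_trans _ _ (beta ^+ 2)); first by rewrite lerXn2r ?nnegrE ?(ltW beta0).
rewrite ler_weXn2l// (@leq_trans D)//; last by rewrite leq_pmull.
by rewrite (leq_trans k_gt1).
Qed.

(** [2 L + 1 <= 2^8 * beta <= beta^9] and [k <= beta ^+ D], because [beta >= 2]; hence the exponent
    [10 * D]. *)
Lemma grid_failure (L : nat) : L%:R <= 96 * beta + 1 ->
  (k * (2 * L).+1 ^ D)%N%:R * Q <= delta / 3.
Proof.
move=> hL; have L9 : (2 * L).+1%:R <= beta ^+ 9.
  apply: (@le_trans _ _ (2 ^+ 8 * beta)).
    rewrite -natr1 natrM; have := beta2; lra.
  by rewrite [leRHS]exprSr ler_wpM2r ?(ltW beta0)// lerXn2r ?nnegrE ?(ltW beta0).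
have kb : k%:R <= beta ^+ D.
  apply: (@le_trans _ _ beta); first by rewrite (le_trans _ Dbeta)// ler_nat.
  by rewrite -[leLHS]expr1 ler_weXn2l// (leq_trans _ kD)// ltnW.
have h1 : (k * (2 * L).+1 ^ D)%N%:R <= beta ^+ (10 * D).
  rewrite natrM natrX.
  have -> : beta ^+ (10 * D) = beta ^+ D * (beta ^+ 9) ^+ D.
    by rewrite -exprM -exprD -mulSn.
  by rewrite ler_pM// lerXn2r// nnegrE ?exprn_ge0 ?(ltW beta0).
apply: le_trans (ler_pM (ler0n _ _) (expR_ge0 _) h1 QE) _.
rewrite (_ : 16 * D = 10 * D + 6 * D)%N; last by rewrite -mulnDl.
rewrite (exprD beta (10 * D)) invfM !mulrA beta_pow mul1r mulrC ler_wpM2l ?(ltW delta0)//.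
rewrite lef_pV2 ?posrE ?exprn_gt0//.
apply: (@le_trans _ _ (2 ^+ 2)); first by lra.
apply: (@le_trans _ _ (beta ^+ 2)); first by rewrite lerXn2r ?nnegrE ?(ltW beta0).
rewrite ler_weXn2l// (@leq_trans D)//; last by rewrite leq_pmull.
by rewrite (leq_trans k_gt1).
Qed.

End numerics.

Lemma measure_bigsetU_le d (T : measurableType d) (R : realType)
    (mu : {measure set T -> \bar R}) (I : Type) (s : seq I) (B : I -> set T)
    (c : R) :
  (forall i, measurable (B i)) -> (forall i, mu (B i) <= c%:E)%E ->
  (mu (\big[setU/set0]_(i <- s) B i) <= ((size s)%:R * c)%:E)%E.
Proof.
move=> mB Bc; elim: s => [|i s ih]; first by rewrite big_nil measure0 mul0r.
rewrite big_cons /= -natr1 mulrDl mul1r addrC EFinD.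
have mU : measurable (\big[setU/set0]_(j <- s) B j) by exact: bigsetU_measurable.
exact: le_trans (measureU2 mu (mB i) mU) (leeD (Bc i) ih).
Qed.

Lemma class_size_ge k c N : (c < k)%N -> (N %/ k <= class_size k c N)%N.
Proof.
move=> ck; rewrite /class_size -[leqLHS]card_ord -sum1_card.
rewrite (big_ord_widen N (fun=> 1%N)) ?leq_div// big_mkcond [leqRHS]big_mkcond.
apply: leq_sum => j _; case: ltnP => // jk.
suff -> : (c + k * j < N)%N by [].
apply: (@leq_trans (k + k * j)); first by rewrite ltn_add2r.
by rewrite -mulnS mulnC (leq_trans _ (leq_divM N k))// leq_mul2r jk orbT.
Qed.

Section good_event.
Context d (T : measurableType d) (R : realType) (P : probability T R).
Context (n m k : nat) (x0 : {RV P >-> 'cV[R]_n}) (w : nat -> {RV P >-> 'cV[R]_n}).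
Context (u : nat -> {RV P >-> 'cV[R]_m}) (xi : nat -> {RV P >-> bool}).
Variables (sigma p eta delta : R) (N : nat).
Hypothesis indep_atom : mutually_independent P (atom_sigma u xi).
Hypothesis hxi_indep : mutually_independent P
  (fun t : nat => g_sigma_algebra_preimage (xi t)).
Hypothesis hxi : forall t, is_bernoulli P p (xi t).
Hypothesis hu : forall t, isotropic_gaussian P sigma (u t).
Hypothesis m_gt0 : (0 < m)%N.
Hypothesis k_gt1 : (1 < k)%N.
Hypothesis sigma_gt0 : 0 < sigma.
Hypothesis p01 : 0 <= p <= 1.
Hypothesis eta_gt0 : 0 < eta.
Hypothesis hx0 : (psi2_norm P (fun o => l2norm (x0 o)) <= eta%:E)%E.
Hypothesis hw : forall t, cond_psi2_le P (sigma_attacks x0 w t)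
  (fun o => l2norm (w t o)) eta.
Hypothesis delta01 : 0 < delta <= 1.
Let q := 1 - (1 - p) ^+ (k - 1).
Let kap := 1 - 2 * q.
Hypothesis kap01 : 0 < kap <= 1.
Let D := (k * m)%N.
Hypothesis hN : 2 ^+ 20 * (k%:R / kap ^+ 2) *
  (D%:R * ln (D%:R / kap) + ln (1 / delta)) <= N%:R.

Let kN : (k <= N)%N.
Proof. exact: (sample_size_ge_order k_gt1 m_gt0 kap01 delta01 hN). Qed.

Let expRN_N : expR (- N%:R) <= delta / 3.
Proof.
apply: le_trans (expRN_sample_size k_gt1 m_gt0 kap01 delta01 hN) _.
exact: (expRN_failure k_gt1 m_gt0 kap01 delta01).
Qed.

Let natr_expR (e : nat) : 2 ^+ e <= expR e%:R :> R.
Proof.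
rewrite -[e%:R]mulr1 expRM_natl lerXn2r ?nnegrE ?expR_ge0//.
by have := expR_ge1Dx (1 : R); lra.
Qed.

(** As [N + k - 1 <= 2 N], the exponential moment is at most [2^(N m) <= exp (N m)], and the
    threshold [2 N m] leaves [exp (- N m)]. *)
Lemma input_energy_tail :
  (P [set o | ((2 * N * m)%N%:R <=
     \sum_(s < N + k.-1) l2norm (u s o) ^+ 2 / (4 * sigma ^+ 2))%R] <=
   (delta / 3)%:E)%E.
Proof.
have mS : measurable_fun [set: T] (fun o => \sum_(s < N + k.-1)
    l2norm (u s o) ^+ 2 / (4 * sigma ^+ 2)).
  apply: measurable_sum => s; apply: measurable_funM => //.
  apply: measurable_funX; apply: (measurableT_comp (@measurable_l2norm _ _)).
  exact: measurable_funP.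
have EX := input_exp_moment indep_atom hu m_gt0 sigma_gt0 (N + k.-1).
apply: le_trans (chernoff_bound (2 * N * m)%N%:R mS EX) _.
rewrite lee_fin; apply: le_trans expRN_N.
have h2 : (Num.sqrt 2 ^+ m) ^+ (N + k.-1) <= expR (N * m)%N%:R :> R.
  apply: le_trans (natr_expR _).
  rewrite -exprM -[X in _ <= X ^+ _](@sqr_sqrtr _ 2)// -exprM.
  apply: ler_weXn2l; last by move: kN k_gt1; clear; nia.
  by rewrite -[leLHS]sqrtr1 ler_wsqrtr// ler1n.
apply: le_trans (ler_wpM2r (expR_ge0 _) h2) _.
rewrite -expRD ler_expR -mulnA natrM.
have : N%:R <= (N * m)%N%:R :> R by rewrite ler_nat leq_pmulr.
lra.
Qed.

Lemma attack_energy_tail :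
  (P [set o | (3 * N%:R <= attack_energy x0 w eta N o)%R] <= (delta / 3)%:E)%E.
Proof.
have mS := adapted_measurable (sub_sigma_algebra_attacks x0 w N)
  (@adapted_attack_energy _ _ _ _ _ x0 w eta N).
have EX := attack_exp_moment eta_gt0 hx0 hw N.
apply: le_trans (chernoff_bound (3 * N%:R) mS EX) _.
rewrite lee_fin; apply: le_trans expRN_N.
apply: le_trans (ler_wpM2r (expR_ge0 _) (natr_expR _)) _.
rewrite -expRD ler_expR -natr1.
have : 1 <= N%:R :> R by rewrite ler1n (leq_trans _ kN)// ltnW.
lra.
Qed.

Let measurable_le_set (X Y : T -> R) : measurable_fun [set: T] X ->
  measurable_fun [set: T] Y -> measurable [set o | (X o <= Y o)%R].
Proof.
move=> mX mY; rewrite -[X in measurable X]setTI.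
exact: (measurable_fun_le measurableT mX mY).
Qed.

Let L := (Num.truncn (96 * (D%:R / kap))).+1.

Let gp (g : {ffun 'I_(\sum_(j < k) m) -> 'I_(2 * L).+1}) := grid_point R g.

(** For the zero grid point the inequality would read [0 <= 0] and hold everywhere, so that point is
    given the empty event. *)
Let bad (a : 'I_k * {ffun 'I_(\sum_(j < k) m) -> 'I_(2 * L).+1}) : set T :=
  if 0 < row_norm (gp a.2) then
    [set o | (\sum_(j < N | (a.1 + k * j < N)%N)
        signed_input u xi (gp a.2) (a.1 + k * j)%N o <=
      (class_size k a.1 N)%:R * (kap / 8) * (sigma * row_norm (gp a.2)))%R]
  else set0.

Let measurable_bad a : measurable (bad a).
Proof.
rewrite /bad; case: ifP => // _; apply: measurable_le_set => //.
under eq_fun do rewrite big_mkcond/=.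
apply: measurable_sum => j; case: (a.1 + k * j < N)%N => //.
exact: measurable_signed.
Qed.

Let grid_tail : (P (\big[setU/set0]_a bad a) <= (delta / 3)%:E)%E.
Proof.
have kap0 : 0 < kap by case/andP: kap01.
have bound a : (P (bad a) <=
    (expR (- (16 * (D%:R * ln (D%:R / kap) + ln (1 / delta)))))%:E)%E.
  rewrite /bad; case: ifP => [ga|_]; last by rewrite measure0 lee_fin expR_ge0.
  have q2 : 2 * q < 1 by rewrite -subr_gt0.
  have h := residue_class_tail indep_atom hxi_indep hxi hu sigma_gt0 p01
    q2 N (ltn_ord a.1) ga.
  apply: le_trans h _; rewrite lee_fin.
  apply: (expRN_class_size k_gt1 m_gt0 kap01 delta01 hN).
  exact: class_size_ge.
apply: le_trans (measure_bigsetU_le _ measurable_bad bound) _.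
rewrite lee_fin -sum1_size sum1_card card_prod card_ord card_ffun !card_ord.
rewrite sum_nat_const card_ord.
apply: (grid_failure k_gt1 m_gt0 kap01 delta01).
rewrite /L -natr1 lerD2r; have := @truncn_itv R (96 * (D%:R / kap)).
by move=> /(_ _)/andP[]//; rewrite mulr_ge0// divr_ge0// ltW.
Qed.

Lemma good_event : exists E : set T, [/\ measurable E, ((1 - delta)%:E <= P E)%E &
  forall o, E o -> [/\
    \sum_(s < N + k.-1) l2norm (u s o) ^+ 2 <= 8 * sigma ^+ 2 * (N * m)%N%:R,
    attack_energy x0 w eta N o <= 3 * N%:R &
    forall v : 'rV[R]_(\sum_(j < k) m), N%:R * (kap * sigma / 16) * row_norm v <=
      \sum_(i < N) signed_input u xi v i o]].
Proof.
have kap0 : 0 < kap by case/andP: kap01.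
have s4 : 0 < 4 * sigma ^+ 2 by rewrite mulr_gt0// exprn_gt0.
set B1 := [set o | ((2 * N * m)%N%:R <=
     \sum_(s < N + k.-1) l2norm (u s o) ^+ 2 / (4 * sigma ^+ 2))%R].
set B2 := [set o | (3 * N%:R <= attack_energy x0 w eta N o)%R].
set B3 := \big[setU/set0]_a bad a.
have mB1 : measurable B1.
  apply: measurable_le_set => //; apply: measurable_sum => s.
  apply: measurable_funM => //.
  apply: measurable_funX; apply: (measurableT_comp (@measurable_l2norm _ _)).
  exact: measurable_funP.
have mB2 : measurable B2.
  apply: measurable_le_set => //.
  exact: (adapted_measurable (sub_sigma_algebra_attacks x0 w N)
    (@adapted_attack_energy _ _ _ _ _ x0 w eta N)).
have mB3 : measurable B3 by apply: bigsetU_measurable.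
have mB12 : measurable (B1 `|` B2) by exact: measurableU.
have mB : measurable (B1 `|` B2 `|` B3) by exact: measurableU.
exists (~` (B1 `|` B2 `|` B3)); split; first exact: measurableC.
  have PB : (P (B1 `|` B2 `|` B3) <= delta%:E)%E.
    apply: le_trans (measureU2 P mB12 mB3) _.
    apply: le_trans (leeD (measureU2 P mB1 mB2) (lexx _)) _.
    apply: le_trans (leeD (leeD input_energy_tail attack_energy_tail) grid_tail) _.
    by rewrite -!EFinD lee_fin; lra.
  by rewrite probability_setC// EFinB; apply: leeB.
move=> o /= /not_orP[/not_orP[/negP nB1 /negP nB2] nB3].
have energy : \sum_(s < N + k.-1) l2norm (u s o) ^+ 2 <=
    8 * sigma ^+ 2 * (N * m)%N%:R.
  move: nB1; rewrite -ltNge -mulr_suml ltr_pdivrMr// => /ltW /le_trans; apply.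
  by rewrite le_eqVlt; apply/orP; left; apply/eqP; rewrite !natrM; ring.
split=> //; first by move: nB2; rewrite -ltNge => /ltW.
apply: (grid_lower_bound m_gt0 k_gt1 sigma_gt0 kap01 kN energy (L := L)).
  rewrite dimE /L; apply: ltW; exact: truncnS_gt.
move=> g g0; rewrite (sum_residues N (fun i => signed_input u xi (grid_point R g) i o)
  (ltnW k_gt1)).
(* The thresholds are proportional to the class sizes, which add up to [N], so the bounds of the
   classes add up to the full one. *)
have -> : N%:R = \sum_(c < k) (class_size k c N)%:R :> R.
  by rewrite -natr_sum /class_size -(sum_residues N (fun=> 1%N) (ltnW k_gt1))
    sum1_card card_ord.
rewrite !mulr_suml; apply: ler_sum => c _.
rewrite leNgt; apply/negP => /ltW h; apply: nB3.
rewrite /B3 -bigcup_seq; exists (c, g) => //=; first by rewrite mem_index_enum.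
by rewrite /bad /= /gp g0.
Qed.

End good_event.

(** * From row vectors to matrices *)

Section euclidean_norms.
Context {R : realType}.

Lemma sum_sqr_ge0 (I : finType) (a : I -> R) : 0 <= \sum_i a i ^+ 2.
Proof. by apply: sumr_ge0 => i _; exact: sqr_ge0. Qed.

(** Termwise, [a b <= t / (2 s) * a^2 + s / (2 t) * b^2] with [s], [t] the two norms; a vanishing
    norm is treated apart. *)
Lemma cauchy_schwarz_sum (I : finType) (a b : I -> R) :
  \sum_i a i * b i <= Num.sqrt (\sum_i a i ^+ 2) * Num.sqrt (\sum_i b i ^+ 2).
Proof.
have zero (c e : I -> R) : Num.sqrt (\sum_i c i ^+ 2) = 0 ->
    \sum_i c i * e i <= 0.
  move=> /eqP; rewrite sqrtr_eq0 => c0; rewrite big1// => i _.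
  have : c i ^+ 2 <= 0.
    by apply: le_trans c0; rewrite (bigD1 i)//= lerDl sumr_ge0// => *; exact: sqr_ge0.
  by rewrite real_exprn_even_le0//= => /eqP ->; rewrite mul0r.
set s := Num.sqrt (\sum_i a i ^+ 2); set t := Num.sqrt (\sum_i b i ^+ 2).
have s0 : 0 <= s by exact: sqrtr_ge0.
have t0 : 0 <= t by exact: sqrtr_ge0.
have [s1|s1] := eqVneq s 0; first by rewrite s1 mul0r; exact: zero.
have [t1|t1] := eqVneq t 0.
  by rewrite t1 mulr0; under eq_bigr do rewrite mulrC; exact: zero.
have s2 : \sum_i a i ^+ 2 = s ^+ 2 by rewrite sqr_sqrtr// sum_sqr_ge0.
have t2 : \sum_i b i ^+ 2 = t ^+ 2 by rewrite sqr_sqrtr// sum_sqr_ge0.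
have sp : 0 < s by rewrite lt_def s1.
have tp : 0 < t by rewrite lt_def t1.
apply: (@le_trans _ _ (\sum_i (t / (2 * s) * a i ^+ 2 + s / (2 * t) * b i ^+ 2))).
  apply: ler_sum => i _; rewrite -subr_ge0.
  rewrite (_ : _ - _ = (t * a i - s * b i) ^+ 2 / (2 * s * t)).
    by rewrite divr_ge0 ?sqr_ge0// !mulr_ge0.
  by field; rewrite s1 t1.
rewrite big_split/= -!mulr_sumr s2 t2 le_eqVlt; apply/orP; left; apply/eqP.
by field; rewrite s1 t1.
Qed.

Lemma l2norm_ge0 n (v : 'cV[R]_n) : 0 <= l2norm v.
Proof. exact: sqrtr_ge0. Qed.

Lemma sqr_l2norm n (v : 'cV[R]_n) : l2norm v ^+ 2 = \sum_i v i 0 ^+ 2.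
Proof. by rewrite sqr_sqrtr// sum_sqr_ge0. Qed.

Lemma l2norm0 n : l2norm (0 : 'cV[R]_n) = 0.
Proof. by rewrite /l2norm big1 ?sqrtr0// => i _; rewrite mxE expr0n. Qed.

Lemma l2normZ n (c : R) (v : 'cV[R]_n) : l2norm (c *: v) = `|c| * l2norm v.
Proof.
rewrite /l2norm; under eq_bigr do rewrite mxE exprMn.
by rewrite -mulr_sumr sqrtrM ?sqr_ge0// sqrtr_sqr.
Qed.

Lemma l2normN n (v : 'cV[R]_n) : l2norm (- v) = l2norm v.
Proof. by rewrite -scaleN1r l2normZ normrN1 mul1r. Qed.

Lemma l2normD n (v v' : 'cV[R]_n) : l2norm (v + v') <= l2norm v + l2norm v'.
Proof.
rewrite -[leRHS]ger0_norm ?addr_ge0 ?l2norm_ge0// -sqrtr_sqr ler_wsqrtr//.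
have := cauchy_schwarz_sum (fun i => v i 0) (fun i => v' i 0).
rewrite -/(l2norm v) -/(l2norm v') => h.
under eq_bigr do rewrite mxE sqrrD.
rewrite !big_split/= -!sqr_l2norm sqrrD mulr2n.
by rewrite lerD2r lerD2l lerD.
Qed.

Lemma l2norm_eq0 n (v : 'cV[R]_n) : l2norm v = 0 -> v = 0.
Proof.
move=> v0; apply/matrixP => i j; rewrite ord1 mxE.
have : v i 0 ^+ 2 <= l2norm v ^+ 2.
  rewrite sqr_l2norm (bigD1 i)//= lerDl.
  by apply: sumr_ge0 => *; exact: sqr_ge0.
by rewrite v0 expr0n/= real_exprn_even_le0//= => /eqP.
Qed.

Lemma l2norm_le_sum n (v : 'cV[R]_n) : l2norm v <= \sum_i `|v i 0|.
Proof.
have s0 : 0 <= \sum_i `|v i 0| by exact: sumr_ge0.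
rewrite -[leRHS]ger0_norm// -sqrtr_sqr ler_wsqrtr// expr2 mulr_suml.
apply: ler_sum => i _; rewrite -real_normK ?num_real// expr2 ler_wpM2l//.
by rewrite (bigD1 i)//= lerDl sumr_ge0.
Qed.

Lemma spectral_norm_ubound a b (M : 'M[R]_(a, b)) :
  has_sup [set l2norm (M *m v) | v in [set v : 'cV[R]_b | l2norm v <= 1]].
Proof.
split; first by exists (l2norm (M *m 0)), 0; rewrite //= l2norm0.
exists (\sum_i \sum_j `|M i j|) => _ [v /= v1 <-].
apply: le_trans (l2norm_le_sum _) _; apply: ler_sum => i _.
rewrite mxE; apply: le_trans (ler_norm_sum _ _ _) _; apply: ler_sum => j _.
rewrite normrM ler_piMr//; apply: le_trans v1.
rewrite -sqrtr_sqr ler_wsqrtr// (bigD1 j)//= lerDl.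
by apply: sumr_ge0 => *; exact: sqr_ge0.
Qed.

Lemma spectral_norm_ge0 a b (M : 'M[R]_(a, b)) : 0 <= spectral_norm M.
Proof.
apply: (ub_le_sup (spectral_norm_ubound M).2); exists 0; first by rewrite /= l2norm0.
by rewrite mulmx0 l2norm0.
Qed.

Lemma l2norm_mulmx_le a b (M : 'M[R]_(a, b)) (v : 'cV[R]_b) :
  l2norm (M *m v) <= spectral_norm M * l2norm v.
Proof.
have [v0|v0] := eqVneq (l2norm v) 0.
  by rewrite (l2norm_eq0 v0) mulmx0 !l2norm0 mulr0.
have vp : 0 < l2norm v by rewrite lt_def v0 l2norm_ge0.
rewrite -ler_pdivrMr// mulrC -[(l2norm v)^-1]gtr0_norm ?invr_gt0// -l2normZ scalemxAr.
apply: (ub_le_sup (spectral_norm_ubound M).2).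
exists ((l2norm v)^-1 *: v) => //=.
by rewrite l2normZ gtr0_norm ?invr_gt0// mulVf.
Qed.

End euclidean_norms.

Section gaussian_projection.
Context d (T : measurableType d) (R : realType) (P : probability T R).
Notation N01 := (@normal_prob R 0 1).

Lemma integral_gauss_abs (X : T -> R) (a : R) : is_gauss P X a ->
  (\int[P]_o `|X o|%:E = (`|a| * gauss_mean_abs)%:E)%E.
Proof.
move=> gX; rewrite (gX (fun x => `|x|%:E))//; last exact/measurable_EFinP.
under eq_integral do rewrite normrM EFinM.
rewrite ge0_integralZl//; first by rewrite gauss_mean_absE.
exact/measurable_EFinP.
Qed.

Lemma integral_sum_gauss_abs (I : finType) (c : I -> R) (X : I -> T -> R)
    (a : I -> R) : (forall i, 0 <= c i) ->
  (forall i, measurable_fun [set: T] (X i)) -> (forall i, is_gauss P (X i) (a i)) ->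
  (\int[P]_o (\sum_i c i * `|X i o|)%:E =
   (gauss_mean_abs * \sum_i c i * `|a i|)%:E)%E.
Proof.
move=> c0 mX gX.
under eq_integral do rewrite -sumEFin.
rewrite ge0_integral_sum//.
- rewrite mulr_sumr -sumEFin; apply: eq_bigr => i _.
  under eq_integral do rewrite EFinM.
  rewrite ge0_integralZl//.
  + by rewrite (integral_gauss_abs (gX i)) -EFinM; congr EFin; ring.
  + by apply/measurable_EFinP; exact: measurableT_comp.
  + by rewrite lee_fin.
- move=> i; apply/measurable_EFinP; apply: measurable_funM => //.
  exact: measurableT_comp.
- by move=> i o _; rewrite lee_fin mulr_ge0.
Qed.

(** The signs are constants here, so taking means multiplies both sides by [gauss_mean_abs], which
    cancels. The terms with negative sign are first moved to the left, so that only nonnegative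
    functions are integrated. *)
Lemma gauss_abs_transfer (I J : finType) (c : I -> R) (X : I -> T -> R)
    (a : I -> R) (s : J -> bool) (Y : J -> T -> R) (b : J -> R) :
  (forall i, 0 <= c i) ->
  (forall i, measurable_fun [set: T] (X i)) -> (forall i, is_gauss P (X i) (a i)) ->
  (forall j, measurable_fun [set: T] (Y j)) -> (forall j, is_gauss P (Y j) (b j)) ->
  (forall o, \sum_i c i * `|X i o| <= \sum_j (-1) ^+ s j * `|Y j o|) ->
  \sum_i c i * `|a i| <= \sum_j (-1) ^+ s j * `|b j|.
Proof.
move=> c0 mX gX mY gY XY.
have split_sign (z : J -> R) : \sum_j (-1) ^+ s j * z j =
    \sum_j (~~ s j)%:R * z j - \sum_j (s j)%:R * z j.
  rewrite -sumrB; apply: eq_bigr => j _.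
  by case: (s j); rewrite /= ?expr1 ?expr0; ring.
have g0 : 0 < gauss_mean_abs :> R by apply: lt_le_trans gauss_mean_abs_ge; lra.
have nat0 (e : J -> bool) j : 0 <= (e j)%:R :> R by exact: ler0n.
have mS (K : finType) (e : K -> R) (Z : K -> T -> R) :
    (forall j, measurable_fun [set: T] (Z j)) ->
    measurable_fun [set: T] (fun o => (\sum_j e j * `|Z j o|)%:E).
  move=> mZ; apply/measurable_EFinP; apply: measurable_sum => j.
  by apply: measurable_funM => //; exact: measurableT_comp.
have pos (K : finType) (e : K -> R) (Z : K -> T -> R) o :
    (forall j, 0 <= e j) -> 0 <= \sum_j e j * `|Z j o|.
  by move=> e0; apply: sumr_ge0 => j _; rewrite mulr_ge0.
rewrite split_sign lerBrDr -(ler_pM2l g0) mulrDr -lee_fin EFinD.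
rewrite -(integral_sum_gauss_abs c0 mX gX).
rewrite -(integral_sum_gauss_abs (nat0 s) mY gY).
rewrite -(integral_sum_gauss_abs (nat0 (fun j => ~~ s j)) mY gY).
have mX' := mS I c X mX.
have mY1 := mS J (fun j => (s j)%:R) Y mY.
have mY2 := mS J (fun j => (~~ s j)%:R) Y mY.
have X0 o : [set: T] o -> (0 <= (\sum_i c i * `|X i o|)%:E)%E.
  by rewrite lee_fin pos.
have Y0 o : [set: T] o -> (0 <= (\sum_j (s j)%:R * `|Y j o|)%:E)%E.
  by rewrite lee_fin pos.
rewrite -(ge0_integralD P measurableT X0 mX' Y0 mY1).
apply: ge0_le_integral => //.
- by move=> o _; rewrite adde_ge0 ?X0 ?Y0.
- exact: emeasurable_funD.
by move=> o _; rewrite -EFinD lee_fin -lerBrDr -split_sign.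
Qed.

Context (m k : nat) (u : nat -> {RV P >-> 'cV[R]_m}) (xi : nat -> {RV P >-> bool}).
Variable sigma : R.
Hypothesis indep_atom : mutually_independent P (atom_sigma u xi).
Hypothesis hu : forall t, isotropic_gaussian P sigma (u t).
Hypothesis m_gt0 : (0 < m)%N.
Hypothesis sigma_gt0 : 0 < sigma.
Local Notation D := (\sum_(j < k) m)%N.

(* For a Gaussian vector [g], [l2norm z] is proportional to the mean of
   [|<g, z>|]; the entries of the inputs provide [g], so that the bound for row
   vectors, applied to [g^T Delta], integrates to the bound for [Delta]. *)
Lemma signed_input_matrix (c : R) (N : nat) (o : T) (r : nat)
    (Delta : 'M[R]_(r, D)) : 0 <= c ->
  (forall v : 'rV[R]_D, c * row_norm v <= \sum_(i < N) signed_input u xi v i o) ->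
  c * frobenius_norm Delta <= \sum_(i < N) (-1) ^+ attacked k xi i o *
    l2norm (Delta *m stacked_input k (fun t => u t o) (i + k.-1)).
Proof.
move=> c0 hc.
pose i0 := Ordinal m_gt0.
(* The integration runs over a second sample point [o'], while [o], and with it the windows and
   signs, stays fixed. As the input process is infinite, it provides [r] Gaussians whatever the
   sample size. *)
pose g (e : 'I_r) o' : R := u e o' i0 0.
have mg (v : 'I_r -> R) : measurable_fun [set: T] (fun o' => \sum_e v e * g e o').
  apply: measurable_sum => e; apply: measurable_funM => //.
  exact: measurable_input.
have gg (v : 'I_r -> R) : is_gauss P (fun o' => \sum_e v e * g e o')
    (sigma * Num.sqrt (\sum_e v e ^+ 2)).
  apply: (is_gauss_sum (sub_sigma_algebra_atom u xi) indep_atom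
    (al := fun e : 'I_r => (e : nat, Some i0)) v (X := g)) => //.
  - exact: ltW.
  - by rewrite map_inj_uniq ?index_enum_uniq// => e e' [/val_inj].
  - by move=> e; exact: adapted_input.
  - by move=> e; exact: is_gauss_input.
pose U i := stacked_input k (fun t => u t o) (i + k.-1).
pose nf (f : 'I_D) := Num.sqrt (\sum_e Delta e f ^+ 2).
set fr := frobenius_norm Delta.
have fr0 : 0 <= fr by exact: sqrtr_ge0.
have nf2 : \sum_f nf f ^+ 2 = fr ^+ 2.
  rewrite /fr sqr_sqrtr; last by apply: sumr_ge0 => i _; exact: sum_sqr_ge0.
  rewrite exchange_big/=; apply: eq_bigr => f _.
  by rewrite sqr_sqrtr// sum_sqr_ge0.
(* The mean of the norm of [g^T Delta] is not computed. The norm is bounded below by its pairing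
   with the unit vector of column norms [nf f / fr], and the mean of that pairing is proportional to
   the sum of [nf f ^+ 2 / fr], which is [fr]. *)
have := @gauss_abs_transfer 'I_D 'I_N (fun f => c * (nf f / fr))
  (fun f o' => \sum_e Delta e f * g e o') (fun f => sigma * nf f)
  (fun i => attacked k xi i o) (fun i o' => \sum_e (Delta *m U i) e 0 * g e o')
  (fun i => sigma * l2norm (Delta *m U i)).
move=> /(_ _ (fun=> mg _) (fun=> gg _) (fun=> mg _) (fun=> gg _)) h.
have {}h : \sum_f c * (nf f / fr) * `|sigma * nf f| <=
  \sum_(i < N) (-1) ^+ attacked k xi i o * `|sigma * l2norm (Delta *m U i)|.
  apply: h => [f|o'].
    by rewrite mulr_ge0// divr_ge0// sqrtr_ge0.
  pose v : 'rV[R]_D := \row_f \sum_e Delta e f * g e o'.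
  have -> : \sum_(i < N) (-1) ^+ attacked k xi i o *
      `|\sum_e (Delta *m U i) e 0 * g e o'| = \sum_(i < N) signed_input u xi v i o.
    apply: eq_bigr => i _; rewrite /signed_input; congr (_ * `|_|).
    rewrite window_inputE mxE.
    under [RHS]eq_bigr do rewrite mxE mulr_suml.
    rewrite exchange_big/=; apply: eq_bigr => e _.
    rewrite mxE mulr_suml; apply: eq_bigr => f _; rewrite -!mulrA; congr (_ * _).
    exact: mulrC.
  apply: le_trans (hc v); under eq_bigr do rewrite -mulrA.
  rewrite -mulr_sumr ler_wpM2l//.
  have := cauchy_schwarz_sum (fun f => nf f / fr) (fun f => `|v 0 f|).
  under [X in X <= _ -> _]eq_bigr do rewrite mxE.
  move=> /le_trans; apply; rewrite /row_norm.
  under [X in _ * Num.sqrt X]eq_bigr do rewrite real_normK ?num_real//.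
  rewrite ler_piMl ?sqrtr_ge0// -[leRHS]sqrtr1 ler_wsqrtr//.
  under eq_bigr do rewrite exprMn.
  rewrite -mulr_suml nf2 -exprMn.
  by have [->|fr1] := eqVneq fr 0; rewrite ?mul0r ?expr0n// divff// expr1n.
have lhs : \sum_f c * (nf f / fr) * `|sigma * nf f| = sigma * (c * fr).
  under eq_bigr => f _.
    rewrite ger0_norm; last by rewrite mulr_ge0 ?sqrtr_ge0// ltW.
    rewrite (_ : _ * _ = sigma * c / fr * nf f ^+ 2); last by ring.
    over.
  rewrite -mulr_sumr nf2; have [->|fr1] := eqVneq fr 0; first by rewrite expr0n !mulr0.
  by field.
rewrite -(ler_pM2l sigma_gt0) -lhs; apply: le_trans h _.
rewrite mulr_sumr le_eqVlt; apply/orP; left; apply/eqP; apply: eq_bigr => i _.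
by rewrite ger0_norm 1?mulrCA// mulr_ge0 ?l2norm_ge0// ltW.
Qed.

End gaussian_projection.

(** * The system *)

Section trajectory.
Context {R : realType} (n m r : nat).
Variables (A : 'M[R]_n) (B : 'M[R]_(n, m)) (C : 'M[R]_(r, n)) (D : 'M[R]_(r, m)).
Variables (x w : nat -> 'cV[R]_n) (u : nat -> 'cV[R]_m) (y : nat -> 'cV[R]_r).
Hypothesis hx : forall t, x t.+1 = A *m x t + B *m u t + w t.
Hypothesis hy : forall t, y t = C *m x t + D *m u t.

Let powS l : A ^+ l.+1 = A *m A ^+ l. Proof. exact: exprS. Qed.

Let powSr l : A ^+ l.+1 = A ^+ l *m A. Proof. exact: exprSr. Qed.

Let pow0 : A ^+ 0 = 1%:M. Proof. exact: expr0. Qed.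

Lemma state_expansion i l : x (i + l)%N = A ^+ l *m x i +
  \sum_(j < l) A ^+ j *m (B *m u (i + (l - j.+1))%N + w (i + (l - j.+1))%N).
Proof.
elim: l => [|l ih]; first by rewrite addn0 big_ord0 addr0 pow0 mul1mx.
rewrite addnS hx ih mulmxDr mulmx_sumr big_ord_recl pow0 mul1mx subSS subn0.
rewrite powS mulmxA -!addrA; congr (_ + _).
rewrite addrC -!addrA; congr (_ + (_ + _)); apply: eq_bigr => j _.
by rewrite mulmxA -powS subSS.
Qed.

Lemma output_expansion i k : (0 < k)%N ->
  y (i + k.-1)%N = markov_params k A B C D *m stacked_input k u (i + k.-1) +
    C *m A ^+ k.-1 *m x i +
    \sum_(j < k.-1) C *m A ^+ j *m w (i + k.-1 - j.+1)%N.
Proof.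
case: k => // k _ /=; rewrite hy state_expansion /markov_params /stacked_input.
rewrite mul_mxrow_mxcol big_ord_recl/= subn0.
rewrite mulmxDr mulmxA mulmx_sumr.
have -> : \sum_(j < k) C *m
    (A ^+ j *m (B *m u (i + (k - j.+1))%N + w (i + (k - j.+1))%N)) =
  \sum_(j < k) C *m A ^+ j *m B *m u (i + k - j.+1)%N +
  \sum_(j < k) C *m A ^+ j *m w (i + k - j.+1)%N.
  rewrite -big_split/=; apply: eq_bigr => j _.
  by rewrite addnBA// !mulmxA mulmxDr !mulmxA.
have -> : \sum_(j < k) (if lift ord0 j == 0%N :> nat then D
      else C *m A ^+ (lift ord0 j).-1 *m B) *m u (i + k - lift ord0 j)%N =
    \sum_(j < k) C *m A ^+ j *m B *m u (i + k - j.+1)%N.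
  by apply: eq_bigr => j _.
by rewrite [LHS]addrC -!addrA; congr (_ + _); exact: addrCA.
Qed.

Variables (psi rho : R).
Hypothesis hrho : 0 <= rho < 1.
Hypothesis hpsi : 0 <= psi.
Hypothesis hA : forall t, spectral_norm (A ^+ t) <= psi * rho ^+ t.

Let drive t := spectral_norm B * l2norm (u t) + l2norm (w t).

Fixpoint state_bound (i : nat) : R :=
  if i is i'.+1 then rho * state_bound i' + drive i' else l2norm (x 0).

(** The induction carries all powers [A ^+ l] at once, so that [psi] enters only once; iterating a
    bound on [x i] alone would multiply by [psi] at every step. *)
Lemma l2norm_state_le i l : l2norm (A ^+ l *m x i) <= psi * rho ^+ l * state_bound i.
Proof.
case/andP: hrho => r0 _.
have pr0 t : 0 <= psi * rho ^+ t by rewrite mulr_ge0 ?exprn_ge0.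
have Al t (z : 'cV[R]_n) : l2norm (A ^+ t *m z) <= psi * rho ^+ t * l2norm z.
  by apply: le_trans (l2norm_mulmx_le _ _) _; rewrite ler_wpM2r ?l2norm_ge0.
elim: i l => [|i ih] l; first exact: Al.
rewrite hx -addrA mulmxDr mulmxA -powSr /=.
apply: le_trans (l2normD _ _) _; rewrite mulrDr mulrA -[_ * rho]mulrA -exprSr.
apply: lerD; first exact: ih.
apply: le_trans (Al _ _) _; rewrite ler_wpM2l//.
apply: le_trans (l2normD _ _) _; rewrite lerD2r; exact: l2norm_mulmx_le.
Qed.

(** Summing the recursion gives an identity in which [state_bound N] is the only extra term; this is
    the origin of the single factor [1 / (1 - rho)]. *)
Lemma sum_state_bound N : (1 - rho) * \sum_(i < N) state_bound i <=
  l2norm (x 0) + \sum_(i < N) drive i.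
Proof.
case/andP: hrho => r0 _.
have d0 i : 0 <= drive i.
  by rewrite addr_ge0 ?mulr_ge0 ?spectral_norm_ge0 ?l2norm_ge0.
have s0 i : 0 <= state_bound i.
  by elim: i => [|i ih] /=; rewrite ?l2norm_ge0// addr_ge0 ?mulr_ge0.
suff : (1 - rho) * \sum_(i < N) state_bound i + state_bound N =
    l2norm (x 0) + \sum_(i < N) drive i by move=> <-; rewrite lerDl.
elim: N => [|N ih]; first by rewrite !big_ord0 mulr0 add0r addr0.
by rewrite !big_ord_recr/= [RHS]addrA -ih; ring.
Qed.

(* The good windows gain at least [l2norm (Delta U)] up to twice the truncation
   error, the attacked ones lose at most that much. *)
Lemma minimizer_signed_sum (k N : nat) (bad : nat -> bool)
    (G : 'M[R]_(r, \sum_(j < k) m)) : (0 < k)%N ->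
  (forall i, ~~ bad i -> forall s, (i <= s < i + k.-1)%N -> w s = 0) ->
  is_minimizer (l2_loss N u y) G ->
  \sum_(i < N) (-1) ^+ bad i *
    l2norm ((markov_params k A B C D - G) *m stacked_input k u (i + k.-1)) <=
  2 * \sum_(i < N) l2norm (C *m A ^+ k.-1 *m x i).
Proof.
move=> k0 hbad /(_ (markov_params k A B C D)).
have lossE H : l2_loss N u y H = \sum_(i < N)
    l2norm (y (i + k.-1)%N - H *m stacked_input k u (i + k.-1)).
  by rewrite /l2_loss -{1}[k.-1]add0n big_addn addnK big_mkord.
rewrite !lossE.
set Gs := markov_params k A B C D.
pose e i := C *m A ^+ k.-1 *m x i.
pose a i := \sum_(j < k.-1) C *m A ^+ j *m w (i + k.-1 - j.+1)%N.
pose U i := stacked_input k u (i + k.-1).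
have yE i : y (i + k.-1)%N = Gs *m U i + e i + a i by exact: output_expansion.
move=> hG.
have step i : (-1) ^+ bad i * l2norm ((Gs - G) *m U i) <=
    l2norm (y (i + k.-1)%N - G *m U i) - l2norm (y (i + k.-1)%N - Gs *m U i) +
    2 * l2norm (e i).
  have -> : y (i + k.-1)%N - G *m U i = (Gs - G) *m U i + (e i + a i).
    by rewrite yE mulmxBl -!addrA; congr (_ + _); rewrite [RHS]addrC -addrA.
  have -> : y (i + k.-1)%N - Gs *m U i = e i + a i.
    by rewrite yE -[_ + e i + a i]addrA addrAC subrr add0r.
  have e0 := l2norm_ge0 (e i).
  set d := (Gs - G) *m U i.
  case: (boolP (bad i)) => [_|nb].
    (* The attack term [a i] occurs in both residuals, which differ by [d], so the loss difference
       is controlled however large the attack is. *)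
    rewrite expr1 mulN1r; have := l2normD (d + (e i + a i)) (- d).
    rewrite l2normN addrAC subrr add0r; lra.
  have a0 : a i = 0.
    rewrite /a big1// => j _; rewrite (hbad i nb) ?mulmx0//.
    by have := ltn_ord j; move: (nat_of_ord j) => j'; clear; lia.
  rewrite a0 addr0 expr0 mul1r; have := l2normD (d + e i) (- e i).
  rewrite l2normN addrK; lra.
apply: le_trans (ler_sum _ _) _ => [i _|]; first exact: step.
by rewrite big_split/= sumrB -mulr_sumr gerDr subr_le0.
Qed.

End trajectory.

(** Used with [n = k - 1] to obtain [q <= (k - 1) p < 1/2]. *)
Lemma bernoulli_inequality (R : realDomainType) (p : R) (n : nat) :
  0 <= p <= 1 -> 1 - n%:R * p <= (1 - p) ^+ n.
Proof.
case/andP=> p0 p1; elim: n => [|n ih]; first by rewrite expr0 mul0r subr0.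
have p1' : 0 <= 1 - p by rewrite subr_ge0.
rewrite exprSr; apply: le_trans (ler_wpM2r p1' ih).
have : 0 <= n%:R * p * p by rewrite !mulr_ge0.
rewrite -natr1; lra.
Qed.

Theorem theorem1 (R : realType) (psi : R) (hpsi : 0 < psi) :
  exists K1 K2 : R, 0 < K1 /\ 0 < K2 /\
  forall (n m r k : nat) (hn : (1 <= n)%N) (hm : (1 <= m)%N) (hr : (1 <= r)%N)
    (hk : (2 <= k)%N)
    (A : 'M[R]_n) (B : 'M[R]_(n, m)) (C : 'M[R]_(r, n)) (D : 'M[R]_(r, m))
    (d : measure_display) (Omega : measurableType d) (P : probability Omega R)
    (x w : nat -> {RV P >-> 'cV[R]_n}) (u : nat -> {RV P >-> 'cV[R]_m})
    (y : nat -> {RV P >-> 'cV[R]_r}) (xi : nat -> {RV P >-> bool})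
    (rho eta p sigma : R)
    (hx : forall t o, x t.+1 o = A *m x t o + B *m u t o + w t o)
    (hy : forall t o, y t o = C *m x t o + D *m u t o)
    (* standing convention on the randomness *)
    (hindep : forall t, mutually_independent P
       (tnth [tuple sigma_future u t; sigma_future xi t;
                    sigma_history (x 0%N) w u t]))
    (* (i) *)
    (hrho : 0 <= rho < 1)
    (hA : forall t, spectral_norm (A ^+ t) <= psi * rho ^+ t)
    (* (ii) *)
    (heta : 0 < eta)
    (hx0 : (psi2_norm P (fun o => l2norm (x 0%N o)) <= eta%:E)%E)
    (hw : forall t, cond_psi2_le P (sigma_attacks (x 0%N) w t)
       (fun o => l2norm (w t o)) eta)
    (* (iii) *)
    (hp : 0 <= p < 1 / (2 * (k - 1)%N%:R))
    (hxi : forall t, is_bernoulli P p (xi t))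
    (hxi_indep : mutually_independent P
       (fun t : nat => g_sigma_algebra_preimage (xi t)))
    (hxi_F : forall t, mutually_independent P
       (tnth [tuple g_sigma_algebra_preimage (xi t);
                    sigma_attacks (x 0%N) w t]))
    (hxi_w : forall t, [set o | xi t o = false] `<=` [set o | w t o = 0])
    (* (iv) *)
    (hsigma : 0 < sigma)
    (hu_indep : mutually_independent P
       (fun t : nat => g_sigma_algebra_preimage (u t)))
    (hu : forall t, isotropic_gaussian P sigma (u t)),
  let q := 1 - (1 - p) ^+ (k - 1) in
  let nu := spectral_norm C / (1 - 2 * q)
            * (eta / sigma + Num.sqrt m%:R * spectral_norm B) in
  forall (delta : R) (N : nat) (hdelta : 0 < delta <= 1)
    (hN : K1 * (k%:R / (1 - 2 * q) ^+ 2)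
          * ((m * k)%N%:R * ln ((m * k)%N%:R / (1 - 2 * q)) + ln (1 / delta))
          <= N%:R),
  (* the event has probability at least 1 - delta: it contains a measurable
     event of that probability *)
  exists E : set Omega,
    [/\ measurable E,
        ((1 - delta)%:E <= P E)%E &
        E `<=` [set o | forall G : 'M[R]_(r, \sum_(j < k) m),
          is_minimizer (l2_loss N (fun t => u t o) (fun t => y t o)) G ->
          frobenius_norm (markov_params k A B C D - G)
            <= K2 * (rho ^+ (k - 1) * nu / (1 - rho))]].
Proof.
(* [160 = 16 * 2 * 5]: the [16] of the uniform lower bound, the [2] from comparing losses, and the
   [5] of the bounds on inputs and attacks below. *)
exists (2 ^+ 20), (160 * psi); split; first by rewrite exprn_gt0.
split; first by rewrite mulr_gt0.
move=> n m r k hn hm hr hk A B C D d Omega P x w u y xi rho eta p sigma hx hy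
  hindep hrho hA heta hx0 hw hp hxi hxi_indep _ hxi_w hsigma hu_indep hu q nu
  delta N hdelta hN.
have p01 : 0 <= p <= 1.
  case/andP: hp => p0 /ltW p1; rewrite p0 (le_trans p1)// ler_pdivrMr ?mul1r.
    by rewrite -natrM ler1n muln_gt0 subn_gt0.
  by rewrite mulr_gt0// ltr0n subn_gt0.
have q2 : 2 * q < 1.
  have k1 : 0 < (k - 1)%N%:R :> R by rewrite ltr0n subn_gt0.
  have := bernoulli_inequality (k - 1) p01.
  have : (k - 1)%N%:R * p < 2^-1.
    case/andP: hp => _; rewrite ltr_pdivlMr ?mulr_gt0//; lra.
  rewrite /q; lra.
have q0 : 0 <= q.
  by rewrite subr_ge0 exprn_ile1//; case/andP: p01 => ? ?; lra.
set kap := 1 - 2 * q.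
have kap0 : 0 < kap by rewrite subr_gt0.
have kap01 : 0 < kap <= 1 by rewrite kap0 /kap; lra.
have indep := atom_indep (hindep 0%N) hxi_indep hu_indep hu hm.
have hN' : 2 ^+ 20 * (k%:R / kap ^+ 2) * ((k * m)%N%:R * ln ((k * m)%N%:R / kap) +
    ln (1 / delta)) <= N%:R by rewrite [(k * m)%N]mulnC.
have [E [mE PE hE]] := good_event indep hxi_indep hxi hu hm hk hsigma p01 heta
  hx0 hw hdelta kap01 hN'.
exists E; split=> // o /hE[u_energy w_energy lower] G Gmin.
have kN : (k <= N)%N := sample_size_ge_order hk hm kap01 hdelta hN'.
have N1 : 1 <= N%:R :> R by rewrite ler1n (leq_trans _ kN)// ltnW.
have N0 : 0 < N%:R :> R by apply: lt_le_trans N1.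
case/andP: (hrho) => rho0 rho1.
set Delta := markov_params k A B C D - G.
have c0 : 0 <= N%:R * (kap * sigma / 16) by rewrite !mulr_ge0// ltW.
have h1 := signed_input_matrix indep hu hm hsigma Delta c0 lower.
have h2 : \sum_(i < N) (-1) ^+ attacked k xi i o *
    l2norm (Delta *m stacked_input k (fun t => u t o) (i + k.-1)) <=
    2 * \sum_(i < N) l2norm (C *m A ^+ k.-1 *m x i o).
  apply: (minimizer_signed_sum (B := B) (x := fun t => x t o) (w := fun t => w t o)
    (y := fun t => y t o) (bad := fun i => attacked k xi i o) _ _ _ _ Gmin) => //.
    exact: ltnW.
  move=> i /hasPn nb s si; apply: hxi_w; apply/negbTE/nb.
  by rewrite mem_iota.
have h3 : \sum_(i < N) l2norm (C *m A ^+ k.-1 *m x i o) <=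
    spectral_norm C * (psi * rho ^+ k.-1) * \sum_(i < N)
      state_bound B (fun t => x t o) (fun t => w t o) (fun t => u t o) rho i.
  rewrite mulr_sumr; apply: ler_sum => i _.
  rewrite -mulmxA; apply: le_trans (l2norm_mulmx_le _ _) _.
  rewrite -mulrA ler_wpM2l ?spectral_norm_ge0//.
  by apply: (l2norm_state_le (x := fun t => x t o)) => //; exact: ltW.
have h4 := sum_state_bound B (fun t => x t o) (fun t => w t o) (fun t => u t o) hrho N.
set S := \sum_(i < N) state_bound _ _ _ _ _ _ in h3 h4.
set sm := Num.sqrt (m%:R : R).
have sm0 : 0 < sm by rewrite sqrtr_gt0 ltr0n.
have sm2 : sm ^+ 2 = m%:R by rewrite sqr_sqrtr.
(* With [tau = sigma * sm], sum [|u| <= |u|^2 / (2 tau) + tau / 2]: the energy bound gives [4] and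
   the constants [1/2]. *)
have hU : \sum_(i < N) l2norm (u i o) <= 5 * N%:R * sigma * sm.
  have tau0 : 0 < sigma * sm by rewrite mulr_gt0.
  apply: (@le_trans _ _ (\sum_(i < N) (l2norm (u i o) ^+ 2 / (2 * (sigma * sm)) +
      sigma * sm / 2))).
    apply: ler_sum => i _; rewrite -subr_ge0.
    rewrite (_ : _ - _ = (l2norm (u i o) - sigma * sm) ^+ 2 / (2 * (sigma * sm))).
      by rewrite divr_ge0 ?sqr_ge0// mulr_ge0// ltW.
    by field; rewrite !gt_eqF.
  rewrite big_split/= -mulr_suml sumr_const card_ord -[_ *+ N]mulr_natr.
  have : \sum_(i < N) l2norm (u i o) ^+ 2 <= 8 * sigma ^+ 2 * (N%:R * sm ^+ 2).
    rewrite sm2 -natrM; apply: le_trans u_energy.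
    have := @sum_shift_le R (fun s => l2norm (u s o) ^+ 2) 0 N (N + k.-1).
    rewrite addn0 leq_addr => /(_ isT (fun s => sqr_ge0 _)).
    by under eq_bigr do rewrite addn0.
  move=> hS; apply: (@le_trans _ _ (8 * sigma ^+ 2 * (N%:R * sm ^+ 2) /
      (2 * (sigma * sm)) + sigma * sm / 2 * N%:R)).
    by rewrite lerD2r ler_pM2r// invr_gt0 mulr_gt0.
  rewrite (_ : _ / (2 * (sigma * sm)) = 4 * (N%:R * sigma * sm)); last first.
    by field; rewrite !gt_eqF.
  have : 0 <= N%:R * sigma * sm by rewrite !mulr_ge0// ltW.
  lra.
(* Each norm is at most [eta] times its term of the attack energy plus one; the total [3 N + N + 1]
   is at most [5 N]. *)
have hW : l2norm (x 0%N o) + \sum_(i < N) l2norm (w i o) <= 5 * N%:R * eta.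
  have e1 : l2norm (x 0%N o) <= (l2norm (x 0%N o) ^+ 2 / (4 * eta ^+ 2) + 1) * eta.
    rewrite -subr_ge0 (_ : _ - _ = (l2norm (x 0%N o) - 2 * eta) ^+ 2 / (4 * eta)).
      by rewrite divr_ge0 ?sqr_ge0// mulr_ge0// ltW.
    by field; rewrite gt_eqF.
  have e2 : \sum_(i < N) l2norm (w i o) <=
      (\sum_(i < N) l2norm (w i o) ^+ 2 / eta ^+ 2 + N%:R) * eta.
    rewrite -[X in _ <= (_ + X) * _](_ : \sum_(i < N) 1 = N%:R); last first.
      by rewrite sumr_const card_ord.
    rewrite -big_split/= mulr_suml; apply: ler_sum => i _.
    set z := l2norm (w i o).
    rewrite -subr_ge0 (_ : _ - _ = ((z - eta / 2) ^+ 2 + 3 / 4 * eta ^+ 2) / eta).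
      apply: divr_ge0; last exact: ltW.
      by rewrite addr_ge0 ?sqr_ge0// mulr_ge0 ?sqr_ge0// divr_ge0.
    by field; rewrite gt_eqF.
  apply: le_trans (lerD e1 e2) _; rewrite -mulrDl ler_pM2r//.
  move: w_energy; rewrite /attack_energy; lra.
have hS : (1 - rho) * S <= 5 * N%:R * (eta + spectral_norm B * (sigma * sm)).
  apply: le_trans h4 _; rewrite big_split/= -mulr_sumr.
  have := ler_wpM2l (spectral_norm_ge0 B) hU; move: hW; lra.
have kap_sigma : 0 < kap * sigma by rewrite mulr_gt0.
have rho1' : 0 < 1 - rho by rewrite subr_gt0.
have hS' : S <= 5 * N%:R * (eta + spectral_norm B * (sigma * sm)) / (1 - rho).
  by rewrite ler_pdivlMr// mulrC.
have Cpr : 0 <= spectral_norm C * (psi * rho ^+ k.-1).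
  by rewrite mulr_ge0 ?spectral_norm_ge0// mulr_ge0 ?exprn_ge0// ltW.
have := le_trans h1 (le_trans h2 (ler_wpM2l (ler0n _ 2)
  (le_trans h3 (ler_wpM2l Cpr hS')))).
(* Division by [N * kap * sigma / 16] removes [N] and turns [eta + |B| * sigma * sm] into the
   bracket of [nu]; what remains is an equality. *)
rewrite mulrC -ler_pdivlMr ?mulr_gt0 ?divr_gt0// => /le_trans; apply.
rewrite subn1 le_eqVlt; apply/orP; left; apply/eqP.
rewrite /nu -/kap -/sm; field.
by rewrite !gt_eqF.
Qed.
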